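(* Let $(\tilde M^{n+p},\tilde F)$ be a Randers manifold with navigation data $(\tilde h,\tilde W)$, where $\tilde W$ is a Killing vector field of $\tilde h$, and let $f:M^n\to(\tilde M^{n+p},\tilde F)$ be a submanifold isometrically immersed, locally given by $\tilde x^\alpha=f^\alpha(x^1,\dots,x^n)$. Then the BH-mean curvature form (resp. the HT-mean curvature form) $\mathcal H_f=\mathcal H_\gamma d\tilde x^\gamma$ of $f$ is given by \begin{align*} \mathcal H_\gamma={}&\frac{2(\log\chi)'}{\varrho}\Big[2\varrho' B^{\eta\delta}\tilde W_\delta\tilde W_\tau(\delta^\tau_\gamma-B^\tau_\gamma)-\varrho(\delta^\eta_\gamma-B^\eta_\gamma)\Big]\tilde W_{\alpha|\eta}\tilde W^\alpha\\ &-\frac1{\varrho}\Big\{4\varrho'B^{\eta\beta}\tilde W_{\alpha|\eta}\tilde W_\beta(\delta^\alpha_\gamma-B^\alpha_\gamma)-2\Big[2\varrho''B^{\eta\delta}\tilde W_\delta\tilde W_\tau(\delta^\tau_\gamma-B^\tau_\gamma)-\varrho'(\delta^\eta_\gamma-B^\eta_\gamma)\Big]\tilde W_{\alpha|\eta}\tilde W^\alpha\Big\}\\ &-\frac1{\varrho}\Big\{h^{ij}\Big[2\varrho'\tilde W_\alpha\tilde W_\beta(\delta^\beta_\gamma-B^\beta_\gamma)+\varrho\tilde h_{\gamma\alpha}\Big]+2\tilde W_\delta\tilde W_\tau A^{i\delta}A^{j\tau}\Big[2\varrho''\tilde W_\alpha\tilde W_\beta(\delta^\beta_\gamma-B^\beta_\gamma)-\varrho'\tilde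 h_{\gamma\alpha}\Big]\Big\}\tau^\alpha_{ij}. \end{align*}
   Context: Navigation data: $\tilde h$ is a Riemannian metric on $\tilde M$ and $\tilde W$ a vector field with $\|\tilde W\|_{\tilde h}<1$; the Randers metric is $\tilde F(\tilde x,y)=\big(\sqrt{\lambda\,\tilde h(y,y)+\tilde h(\tilde W,y)^2}-\tilde h(\tilde W,y)\big)/\lambda$ with $\lambda=1-\|\tilde W\|^2_{\tilde h}$; $M$ carries the induced metric $f^*\tilde F$. Index ranges $1\le i,j,k\le n$, $1\le\alpha,\beta,\gamma,\eta,\delta,\tau\le n+p$, summation convention. Notation: $z^\alpha_i=\partial f^\alpha/\partial x^i$, $\tilde W_\alpha=\tilde h_{\alpha\beta}\tilde W^\beta$, $h_{ij}=\tilde h_{\alpha\beta}z^\alpha_iz^\beta_j$, $(h^{ij})=(h_{ij})^{-1}$, $W_i=\tilde W_\alpha z^\alpha_i$, $\|W\|^2_h=h^{ij}W_iW_j$, $\mathfrak s=1-\|\tilde W\|^2_{\tilde h}+\|W\|^2_h$, $A^{i\alpha}=h^{ij}z^\alpha_j$, $B^{\alpha\beta}=h^{ij}z^\alpha_iz^\beta_j$, $B^\alpha_\beta=B^{\alpha\delta}\tilde h_{\delta\beta}$. $\tilde W^\beta_{|\eta}$ are the components of $\nabla^{\tilde h}\tilde W$, $\tilde W_{\alpha|\eta}=\tilde h_{\alpha\beta}\tilde W^\beta_{|\eta}$. $\tau^\alpha_{ij}=\frac{\partial^2f^\alpha}{\partial x^i\partial x^j}+\tilde\Gamma^\alpha_{\tau\delta}z^\tau_jz^\delta_i-\Gamma^k_{ij}z^\alpha_k$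 is the second fundamental form of $f:(M,h)\to(\tilde M,\tilde h)$. Volume data: $(\varrho,\chi)=(\mathfrak s^{-n/2},1)$ in the Busemann–Hausdorff (BH) case and $(\varrho,\chi)=(\mathfrak s^{1/2},(1-\|\tilde W\|^2_{\tilde h})^{(n+1)/2})$ in the Holmes–Thompson (HT) case; $\varrho',\varrho''$ are derivatives in $\mathfrak s$; $(\log\chi)'$ is the derivative of $\log\chi$ with respect to $\|\tilde W\|^2_{\tilde h}$. With $\mathcal F=\frac{\varrho(\mathfrak s)}{\chi}\sqrt{\det(h_{ij})}$ viewed as a function of $\tilde x$ and $z=(z^\alpha_i)$, the mean curvature form is defined by $\mathcal H_\gamma=\frac1{\mathcal F}\Big\{\frac{\partial\mathcal F}{\partial\tilde x^\gamma}-\frac{\partial^2\mathcal F}{\partial z^\gamma_i\partial z^\eta_j}\frac{\partial^2 f^\eta}{\partial x^i\partial x^j}-\frac{\partial^2\mathcal F}{\partial\tilde x^\eta\partial z^\gamma_i}\frac{\partial f^\eta}{\partial x^i}\Big\}$. *)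

(* Defs.v *)
(* Everything is in local coordinates. *)
From HB Require Import structures.
From mathcomp Require Import all_boot all_order all_algebra.
From mathcomp Require Import all_classical all_reals all_analysis.
Set Implicit Arguments. Unset Strict Implicit. Unset Printing Implicit Defensive.
Import Order.TTheory GRing.Theory Num.Theory.
Import numFieldNormedType.Exports.
Local Open Scope classical_set_scope.
Local Open Scope ring_scope.

Section Defs.
Variable R : realType.

Definition ev {N} (k : 'I_N) : 'rV[R]_N := delta_mx 0 k.

Definition pd {N} (k : 'I_N) (g : 'rV[R]_N -> R) : 'rV[R]_N -> R :=
  fun x => derive1 (fun t : R => g (x + t *: ev k)) 0.

Fixpoint iter_pd {N} (ks : seq 'I_N) (g : 'rV[R]_N -> R) : 'rV[R]_N -> R :=
  if ks is k :: ks' then pd k (iter_pd ks' g) else g.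

Definition smooth_on {N} (U : set 'rV[R]_N) (g : 'rV[R]_N -> R) : Prop :=
  forall (ks : seq 'I_N) (x : 'rV[R]_N), U x ->
    {for x, continuous (iter_pd ks g)} /\
    forall k : 'I_N, derivable (fun t : R => iter_pd ks g (x + t *: ev k)) 0 1.

Definition kron {N} (a b : 'I_N) : R := (a == b)%:R.

Section Ambient.
Variable N : nat.
Variable ht : 'rV[R]_N -> 'M[R]_N.
Variable Wt : 'rV[R]_N -> 'rV[R]_N.

Definition htinv (x : 'rV[R]_N) : 'M[R]_N := invmx (ht x).

Definition Gammat (x : 'rV[R]_N) (a t d : 'I_N) : R :=
  2^-1 * \sum_(b < N) htinv x a b *
    (pd t (fun y => ht y b d) x + pd d (fun y => ht y b t) x
     - pd b (fun y => ht y t d) x).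

Definition Wlow (x : 'rV[R]_N) (a : 'I_N) : R :=
  \sum_(b < N) ht x a b * Wt x 0 b.

Definition Wnorm2 (x : 'rV[R]_N) : R := \sum_(a < N) Wlow x a * Wt x 0 a.

Definition Wcov (x : 'rV[R]_N) (b e : 'I_N) : R :=
  pd e (fun y => Wt y 0 b) x + \sum_(d < N) Gammat x b e d * Wt x 0 d.

Definition Wcovlow (x : 'rV[R]_N) (a e : 'I_N) : R :=
  \sum_(b < N) ht x a b * Wcov x b e.

Definition Killing (U : set 'rV[R]_N) : Prop :=
  forall x, U x -> forall a e : 'I_N, Wcovlow x a e + Wcovlow x e a = 0.
End Ambient.

Inductive volume := BH | HT.

Definition rho (v : volume) (n : nat) (s : R) : R :=
  match v with
  | BH => (Num.sqrt s ^+ n)^-1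
  | HT => Num.sqrt s
  end.

(* chi as a function of w = ||W~||^2 *)
Definition chi (v : volume) (n : nat) (w : R) : R :=
  match v with
  | BH => 1
  | HT => Num.sqrt (1 - w) ^+ n.+1
  end.

Definition rho' v n : R -> R := derive1 (rho v n).
Definition rho'' v n : R -> R := derive1 (derive1 (rho v n)).
Definition logchi' v n : R -> R := derive1 (fun w => ln (chi v n w)).

Definition Fvol (v : volume) (n p : nat) (ht : 'rV[R]_(n + p) -> 'M[R]_(n + p))
  (Wt : 'rV[R]_(n + p) -> 'rV[R]_(n + p))
  (xt : 'rV[R]_(n + p)) (z : 'M[R]_(n + p, n)) : R :=
  let hz : 'M[R]_n := z^T *m ht xt *m z in
  let Wi : 'rV[R]_n := \row_(i < n) \sum_(a < n + p) Wlow ht Wt xt a * z a i in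
  let w := Wnorm2 ht Wt xt in
  let s := 1 - w + (Wi *m invmx hz *m Wi^T) 0 0 in
  rho v n s / chi v n w * Num.sqrt (\det hz).

Definition dxt {N n} (g : 'I_N) (G : 'rV[R]_N -> 'M[R]_(N, n) -> R)
  : 'rV[R]_N -> 'M[R]_(N, n) -> R :=
  fun xt z => derive1 (fun t : R => G (xt + t *: ev g) z) 0.
Definition dz {N n} (g : 'I_N) (i : 'I_n) (G : 'rV[R]_N -> 'M[R]_(N, n) -> R)
  : 'rV[R]_N -> 'M[R]_(N, n) -> R :=
  fun xt z => derive1 (fun t : R => G xt (z + t *: delta_mx g i)) 0.

Section Immersion.
Variables n p : nat.
Variable ht : 'rV[R]_(n + p) -> 'M[R]_(n + p).
Variable Wt : 'rV[R]_(n + p) -> 'rV[R]_(n + p).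
Variable f : 'rV[R]_n -> 'rV[R]_(n + p).

Definition zf (x : 'rV[R]_n) : 'M[R]_(n + p, n) :=
  \matrix_(a < n + p, i < n) pd i (fun y => f y 0 a) x.

Definition hind (x : 'rV[R]_n) : 'M[R]_n := (zf x)^T *m ht (f x) *m zf x.
Definition hinv (x : 'rV[R]_n) : 'M[R]_n := invmx (hind x).

Definition Gamma (x : 'rV[R]_n) (k i j : 'I_n) : R :=
  2^-1 * \sum_(l < n) hinv x k l *
    (pd i (fun y => hind y l j) x + pd j (fun y => hind y l i) x
     - pd l (fun y => hind y i j) x).

Definition tau (x : 'rV[R]_n) (a : 'I_(n + p)) (i j : 'I_n) : R :=
  pd i (pd j (fun y => f y 0 a)) x
  + \sum_(t < n + p) \sum_(d < n + p)
      Gammat ht (f x) a t d * zf x t j * zf x d i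
  - \sum_(k < n) Gamma x k i j * zf x a k.

Definition Aup (x : 'rV[R]_n) (i : 'I_n) (a : 'I_(n + p)) : R :=
  \sum_(j < n) hinv x i j * zf x a j.
Definition Bup (x : 'rV[R]_n) (a b : 'I_(n + p)) : R :=
  \sum_(i < n) \sum_(j < n) hinv x i j * zf x a i * zf x b j.
Definition Bmix (x : 'rV[R]_n) (a b : 'I_(n + p)) : R :=
  \sum_(d < n + p) Bup x a d * ht (f x) d b.

Definition sfrak (x : 'rV[R]_n) : R :=
  1 - Wnorm2 ht Wt (f x)
  + \sum_(i < n) \sum_(j < n) hinv x i j *
      (\sum_(a < n + p) Wlow ht Wt (f x) a * zf x a i) *
      (\sum_(a < n + p) Wlow ht Wt (f x) a * zf x a j).

Definition meancurv (v : volume) (x : 'rV[R]_n) (g : 'I_(n + p)) : R :=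
  let F := Fvol v ht Wt in
  (F (f x) (zf x))^-1 *
  (dxt g F (f x) (zf x)
   - \sum_(i < n) \sum_(e < n + p) \sum_(j < n)
        dz g i (dz e j F) (f x) (zf x) * pd i (pd j (fun y => f y 0 e)) x
   - \sum_(e < n + p) \sum_(i < n)
        dxt e (dz g i F) (f x) (zf x) * pd i (fun y => f y 0 e) x).
End Immersion.

End Defs.
Arguments kron {R N} a b.

(* Main.v *)
(* The density F depends on its point only through the triple (h, W, z), where z
   stands for df, and this dependence is invariant under GL(N).  Since
   d_e h = G_e^T h + h G_e with (G_e)^a_b = Gamma~^a_{eb}, infinitesimal invariance
   trades the variation (d_e h, d_e W, 0) for (0, W_{|e}, G_e z): the Euler-Lagrange
   expression then only involves the covariant derivative of W and the matrices
   f_ij + Gamma~ z_i z_j = tau_ij + Gamma^k_ij z_k.  The tangential part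
   Gamma^k_ij z_k drops out because F_z z = F id and Gamma is symmetric in (i, j).
   The variations along (0, W_{|e}, 0) and along the normal vectors tau_ij are
   explicit; by antisymmetry of W_{a|e} its contractions with the symmetric tensors
   B^{ae} and B^{ad} W_d B^{et} W_t vanish. *)
Require Import Defs.
From HB Require Import structures.
From mathcomp Require Import all_boot all_order all_algebra.
From mathcomp Require Import all_classical all_reals all_analysis.
From mathcomp Require Import perm ring lra.
Import Order.TTheory GRing.Theory Num.Theory.
Import numFieldNormedType.Exports.
Local Open Scope classical_set_scope.
Local Open Scope ring_scope.
Set Implicit Arguments. Unset Strict Implicit. Unset Printing Implicit Defensive.

(** * Variations of the Lagrangian *)

(** The proof has two layers. The algebraic one works over any [numFieldType] with rho, rho', rho''
    and (log chi)' as free scalars, so BH and HT are treated at once and every identity is between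
    matrix words. The analytic one shows that derivatives of the density along curves are these
    words at the actual values of rho and chi. Derivatives are [derive1], meaningful only where the
    function is derivable, so the closed forms are used on neighbourhoods: hence the open condition
    [regular] and its derivation from positive definiteness. The geometry behind the formulas is s =
    1 - |W^perp|^2, with W^perp the component of W normal to the image of z. First variations of s
    are thus contractions with W^perp, which in indices is the factor W_t (delta^t_g - B^t_g) of the
    statement. [smooth_on] only speaks of partials along coordinate axes. Symmetry of second
    partials and the chain rule along f are therefore derived by hand from the mean value theorem;
    they give the symmetry of the Hessian of f and the derivatives of the induced metric, hence the
    normality and symmetry of tau. *)

Section Variation.
Variables (R : numFieldType) (N n : nat).
Variables (h : 'M[R]_N) (W : 'cV[R]_N) (z : 'M[R]_(N, n)).
Variables (r r1 r2 lc : R).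

(* [r], [r1], [r2], [lc] stand for rho, rho', rho'' and (log chi)'; [momentum] is
   F_z divided by sqrt(det h_ij) / chi.  For a variation X = (dh, dW, dz), [dlagr X]
   and [dmomentum X] are the derivatives of F and F_z divided by that same factor. *)
Definition gram : 'M[R]_n := z^T *m h *m z.
Definition cogram : 'M[R]_n := invmx gram.
Definition wlow : 'rV[R]_n := W^T *m h *m z.
Definition wup : 'rV[R]_n := wlow *m cogram.
(** [z *m wup^T] is the h-orthogonal projection of W on the image of z, so this is the normal
    component, and [sgoth] equals 1 minus its squared norm when h is symmetric and the Gram matrix
    invertible. *)
Definition wperp : 'cV[R]_N := W - z *m wup^T.
Definition wnorm : R := \tr (W^T *m h *m W).
Definition sgoth : R := 1 - wnorm + \tr (wlow *m cogram *m wlow^T).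
Definition momentum : 'M[R]_(N, n) :=
  (2 * r1) *: (h *m wperp *m wup) + r *: (h *m z *m cogram).

Definition tangent := ('M[R]_N * 'cV[R]_N * 'M[R]_(N, n))%type.
Implicit Type X : tangent.
Definition dgram X : 'M[R]_n :=
  X.2^T *m h *m z + z^T *m X.1.1 *m z + z^T *m h *m X.2.
Definition dwlow X : 'rV[R]_n :=
  X.1.2^T *m h *m z + W^T *m X.1.1 *m z + W^T *m h *m X.2.
Definition dcogram X : 'M[R]_n := - (cogram *m dgram X *m cogram).
Definition dwup X : 'rV[R]_n := dwlow X *m cogram + wlow *m dcogram X.
Definition dwperp X : 'cV[R]_N := X.1.2 - (X.2 *m wup^T + z *m (dwup X)^T).
Definition dwnorm X : R :=
  \tr (X.1.2^T *m h *m W) + \tr (W^T *m X.1.1 *m W) + \tr (W^T *m h *m X.1.2).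
Definition dsgoth X : R :=
  - dwnorm X + (\tr (dwup X *m wlow^T) + \tr (wup *m (dwlow X)^T)).
Definition dlogvol X : R := 2^-1 * \tr (cogram *m dgram X).
Definition dlagr X : R := r1 * dsgoth X + r * (dlogvol X - lc * dwnorm X).
Definition dmomentum X : 'M[R]_(N, n) :=
  (dlogvol X - lc * dwnorm X) *: momentum
  + ((2 * (r2 * dsgoth X)) *: (h *m wperp *m wup)
     + (2 * r1) *: ((X.1.1 *m wperp + h *m dwperp X) *m wup
                    + h *m wperp *m dwup X))
  + ((r1 * dsgoth X) *: (h *m z *m cogram)
     + r *: ((X.1.1 *m z + h *m X.2) *m cogram + h *m z *m dcogram X)).

Lemma addmxE m p (A B : 'M[R]_(m, p)) i j : (A + B) i j = A i j + B i j.
Proof. by rewrite mxE. Qed.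
Lemma oppmxE m p (A : 'M[R]_(m, p)) i j : (- A) i j = - A i j.
Proof. by rewrite mxE. Qed.
Lemma scalemxE m p a (A : 'M[R]_(m, p)) i j : (a *: A) i j = a * A i j.
Proof. by rewrite mxE. Qed.
Lemma trmx_entry m p (A : 'M[R]_(m, p)) i j : A^T i j = A j i.
Proof. by rewrite mxE. Qed.
Lemma trmxD m p (A B : 'M[R]_(m, p)) : (A + B)^T = A^T + B^T.
Proof. exact: raddfD. Qed.
Lemma trmxN m p (A : 'M[R]_(m, p)) : (- A)^T = - A^T.
Proof. exact: raddfN. Qed.
Lemma trmxZ m p a (A : 'M[R]_(m, p)) : (a *: A)^T = a *: A^T.
Proof. exact: linearZ. Qed.
Lemma mxtraceN m (A : 'M[R]_m) : \tr (- A) = - \tr A.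
Proof. exact: raddfN. Qed.

Lemma mxtrace_trmul m p (A B : 'M[R]_(m, p)) : \tr (A^T *m B) = \sum_i \sum_j A i j * B i j.
Proof.
rewrite exchange_big; apply: eq_bigr => j _; rewrite mxE.
by apply: eq_bigr => i _; rewrite mxE.
Qed.

Lemma mxtrace_delta m p (A : 'M[R]_(m, p)) i j : \tr (A^T *m delta_mx i j) = A i j.
Proof.
rewrite mxtrace_trmul (bigD1 i) //= [X in _ + X]big1 ?addr0; last first.
  by move=> k ki; rewrite big1 // => l _; rewrite mxE (negbTE ki) mulr0.
rewrite (bigD1 j) //= big1 ?addr0; first by rewrite mxE !eqxx mulr1.
by move=> l lj; rewrite mxE (negbTE lj) andbF mulr0.
Qed.

(** A normal form: sums of scaled, left-associated words with transposes on the letters. Equal words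
    become syntactically equal, so [ring] can treat their entries or traces as atoms. *)
Definition mxdistr := (trmxD, trmxN, trmxZ, @trmx_mul R, @trmxK R, mulmxDl, mulmxDr,
   mulmxN, mulNmx, =^~ scalemxAl, =^~ scalemxAr, mulmxA, mxtraceD, mxtraceN, mxtraceZ).
Definition mxentry := (addmxE, oppmxE, scalemxE).


(** Linearity in the variation, here and in the next lemmas, is what allows a coordinate derivative
    to be split into an orbit direction, a covariant derivative of W and a variation of z. *)
Lemma dgram_linear : linear dgram.
Proof.
move=> a [[h1 W1] z1] [[h2 W2] z2]; rewrite /dgram /= !mxdistr.
by apply/matrixP => i j; rewrite !mxentry; ring.
Qed.
Lemma dwlow_linear : linear dwlow.
Proof.
move=> a [[h1 W1] z1] [[h2 W2] z2]; rewrite /dwlow /= !mxdistr.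
by apply/matrixP => i j; rewrite !mxentry; ring.
Qed.
Lemma dcogram_linear : linear dcogram.
Proof.
move=> a X Y; rewrite /dcogram dgram_linear.
move: (dgram X) (dgram Y) cogram => A B K; rewrite !mxdistr.
by apply/matrixP => i j; rewrite !mxentry; ring.
Qed.
Lemma dwup_linear : linear dwup.
Proof.
move=> a X Y; rewrite /dwup dwlow_linear dcogram_linear.
move: (dwlow X) (dwlow Y) (dcogram X) (dcogram Y) wlow cogram => A B C D w K.
rewrite !mxdistr.
by apply/matrixP => i j; rewrite !mxentry; ring.
Qed.
Lemma dwperp_linear : linear dwperp.
Proof.
move=> a X Y; rewrite /dwperp dwup_linear.
move: (dwup X) (dwup Y) wup => A B w.
case: X Y => [[h1 W1] z1] [[h2 W2] z2] /=; rewrite !mxdistr.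
by apply/matrixP => i j; rewrite !mxentry; ring.
Qed.
Lemma dwnorm_linear : linear (dwnorm : tangent -> R^o).
Proof.
move=> a [[h1 W1] z1] [[h2 W2] z2]; rewrite /dwnorm /= !mxdistr /GRing.scale /=.
by ring.
Qed.
Lemma dsgoth_linear : linear (dsgoth : tangent -> R^o).
Proof.
move=> a X Y; rewrite /dsgoth dwnorm_linear dwup_linear dwlow_linear.
move: (dwup X) (dwup Y) (dwlow X) (dwlow Y) wlow wup => A B C D w u.
rewrite !mxdistr /GRing.scale /=; move: (dwnorm X) (dwnorm Y) => e f; ring.
Qed.
Lemma dlogvol_linear : linear (dlogvol : tangent -> R^o).
Proof.
move=> a X Y; rewrite /dlogvol dgram_linear.
move: (dgram X) (dgram Y) cogram => A B K; rewrite !mxdistr /GRing.scale /=; ring.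
Qed.
Lemma dlagr_linear : linear (dlagr : tangent -> R^o).
Proof.
move=> a X Y; rewrite /dlagr dsgoth_linear dlogvol_linear dwnorm_linear.
rewrite /GRing.scale /=; move: (dsgoth X) (dsgoth Y) (dlogvol X) (dlogvol Y) (dwnorm X) (dwnorm Y).
by move=> *; ring.
Qed.
Lemma dmomentum_linear : linear dmomentum.
Proof.
move=> a X Y; rewrite /dmomentum dlogvol_linear dsgoth_linear dwnorm_linear dwperp_linear.
rewrite dwup_linear dcogram_linear.
move: (dsgoth X) (dsgoth Y) (dlogvol X) (dlogvol Y) (dwnorm X) (dwnorm Y).
move: (dwperp X) (dwperp Y) (dwup X) (dwup Y) (dcogram X) (dcogram Y).
move: momentum wperp wup cogram => M y w K A B C D E F a1 a2 a3 a4 a5 a6.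
case: X Y => [[h1 W1] z1] [[h2 W2] z2] /=; rewrite !mxdistr /GRing.scale /=.
by apply/matrixP => i j; rewrite !mxentry; ring.
Qed.

Hypothesis hT : h^T = h.
Hypothesis gram_unit : gram \in unitmx.

Lemma gram_sym : gram^T = gram.
Proof. by rewrite /gram !trmx_mul trmxK hT mulmxA. Qed.

Lemma cogram_sym : cogram^T = cogram.
Proof. by rewrite /cogram trmx_inv gram_sym. Qed.

Lemma mulVgram : cogram *m gram = 1%:M.
Proof. exact: mulVmx. Qed.

Lemma mulgramV : gram *m cogram = 1%:M.
Proof. exact: mulmxV. Qed.

Lemma wup_tr : wup^T = cogram *m z^T *m h *m W.
Proof. by rewrite /wup /wlow !trmx_mul cogram_sym trmxK hT !mulmxA. Qed.

Lemma wperp_normal : z^T *m h *m wperp = 0.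
Proof.
rewrite /wperp mulmxBr wup_tr !mulmxA -/gram /cogram mulmxV // mul1mx; exact: subrr.
Qed.

Lemma wperp_normal_tr : wperp^T *m h *m z = 0.
Proof. by apply: trmx_inj; rewrite !trmx_mul trmxK hT mulmxA wperp_normal trmx0. Qed.

Lemma dsgothE X : dsgoth X = - dwnorm X + 2 * \tr (dwlow X *m wup^T) - \tr (wup *m dgram X *m wup^T).
Proof.
rewrite /dsgoth; have e : wup^T = cogram *m wlow^T by rewrite /wup [LHS]trmx_mul cogram_sym.
have -> : \tr (wup *m (dwlow X)^T) = \tr (dwlow X *m wup^T).
  by rewrite -mxtrace_tr (trmx_mul wup) trmxK.
have -> : \tr (dwup X *m wlow^T) =
    \tr (dwlow X *m wup^T) - \tr (wup *m dgram X *m wup^T).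
  rewrite /dwup /dcogram e mulmxDl mulmxN mulNmx !mulmxA -/wup.
  by rewrite mxtraceD mxtraceN.
ring.
Qed.

Section Equivariance.
Variable G : 'M[R]_N.
(* The infinitesimal action of [G] in gl(N) on (h, W, z). *)
Let X : tangent := (G^T *m h + h *m G, - (G *m W), - (G *m z)).

Let dgram0 : dgram X = 0.
Proof.
rewrite /dgram /= !mxdistr; apply/matrixP => i j; rewrite !mxentry [RHS]mxE; ring.
Qed.
Let dwlow0 : dwlow X = 0.
Proof.
rewrite /dwlow /= !mxdistr; apply/matrixP => i j; rewrite !mxentry [RHS]mxE; ring.
Qed.
Let dwup0 : dwup X = 0.
Proof.
by rewrite /dwup /dcogram dgram0 dwlow0 mulmx0 !mul0mx oppr0 mulmx0 addr0.
Qed.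
Let dwnorm0 : dwnorm X = 0.
Proof. by rewrite /dwnorm /= !mxdistr; ring. Qed.
Let dsgoth0 : dsgoth X = 0.
Proof. by rewrite /dsgoth dwnorm0 dwup0 dwlow0 !(trmx0, mul0mx, mulmx0, mxtrace0); ring. Qed.
Let dlogvol0 : dlogvol X = 0.
Proof. by rewrite /dlogvol dgram0 mulmx0 mxtrace0 mulr0. Qed.

(** The density is built from [gram], [wlow] and [wnorm], full contractions with h, and these are
    constant along the orbits. *)
Lemma dlagr_equiv : dlagr X = 0.
Proof. by rewrite /dlagr dsgoth0 dlogvol0 dwnorm0; ring. Qed.

(** The momentum is a covector in z: along the orbit on which z moves by -G it moves by the dual
    action, hence by [G^T]. *)
Lemma dmomentum_equiv : dmomentum X = G^T *m momentum.
Proof.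
have dy : dwperp X = - (G *m wperp).
  rewrite /dwperp dwup0 trmx0 mulmx0 addr0 /= /wperp.
  move: wup => w; rewrite !mxdistr opprK opprB addrC //.
rewrite /dmomentum dlogvol0 dsgoth0 dwnorm0 dy dwup0 /dcogram dgram0 /momentum /=.
move: wperp wup cogram => y w K.
rewrite !(mxdistr, mulmx0, mul0mx, oppr0).
by rewrite !(scale0r, addr0, add0r, mulr0); apply/matrixP => i j; rewrite !mxentry; ring.
Qed.
End Equivariance.

Section ImmersionVariation.
Variable Z : 'M[R]_(N, n).
Let X : tangent := (0, 0, Z).

Lemma dgram_z : dgram X = Z^T *m h *m z + z^T *m h *m Z.
Proof. by rewrite /dgram /= mulmx0 mul0mx addr0. Qed.
Lemma dwlow_z : dwlow X = W^T *m h *m Z.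
Proof. by rewrite /dwlow /= trmx0 mulmx0 !mul0mx !add0r. Qed.
Lemma dwnorm_z : dwnorm X = 0.
Proof. by rewrite /dwnorm /= trmx0 !mulmx0 !mul0mx !mxtrace0 !addr0. Qed.
Lemma dlogvol_z : dlogvol X = \tr (cogram *m z^T *m h *m Z).
Proof.
rewrite /dlogvol dgram_z mulmxDr mxtraceD.
rewrite -(mxtrace_tr (cogram *m (Z^T *m h *m z))) !trmx_mul trmxK cogram_sym hT.
by rewrite [X in _ * (X + _)]mxtrace_mulC !mulmxA; field; rewrite ?pnatr_eq0.
Qed.
Lemma dsgoth_z : dsgoth X = 2 * \tr (wperp^T *m h *m Z *m wup^T).
Proof.
rewrite dsgothE dwnorm_z dgram_z dwlow_z.
rewrite /wperp; move: wup => w; rewrite !mxdistr.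
have -> : \tr (w *m Z^T *m h *m z *m w^T) = \tr (w *m z^T *m h *m Z *m w^T).
  by rewrite -mxtrace_tr !trmx_mul !trmxK hT !mulmxA.
ring.
Qed.

(** This justifies the formula for [momentum]: it is the z-gradient for the pairing
    [\tr (A^T *m B)]. *)
Lemma dlagr_z : dlagr X = \tr (momentum^T *m Z).
Proof.
rewrite /dlagr dwnorm_z dsgoth_z dlogvol_z /momentum.
have -> : \tr (wperp^T *m h *m Z *m wup^T) = \tr (wup^T *m wperp^T *m h *m Z).
  by rewrite mxtrace_mulC !mulmxA.
have := cogram_sym; move: wperp wup cogram => y w K KT.
rewrite !mxdistr hT KT; ring.
Qed.

(** A normal variation of z fixes the Gram matrix to first order, so its inverse and the volume
    factor do not move; what remains comes from h z and from the splitting of W into tangential and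
    normal parts. *)
Lemma dmomentum_normal : z^T *m h *m Z = 0 ->
  dmomentum X =
    (4 * r2 * \tr (W^T *m h *m Z *m wup^T)) *: (h *m wperp *m wup)
  + (2 * r1) *: (h *m wperp *m W^T *m h *m Z *m cogram
       - h *m Z *m wup^T *m wup - h *m z *m cogram *m Z^T *m h *m W *m wup)
  + (2 * r1 * \tr (W^T *m h *m Z *m wup^T)) *: (h *m z *m cogram)
  + r *: (h *m Z *m cogram).
Proof.
move=> nZ; have nZT : Z^T *m h *m z = 0.
  by apply: trmx_inj; rewrite !trmx_mul trmxK hT mulmxA nZ trmx0.
have dH : dgram X = 0 by rewrite dgram_z nZ nZT addr0.
have dK : dcogram X = 0 by rewrite /dcogram dH mulmx0 mul0mx oppr0.
have dl : dlogvol X = 0 by rewrite /dlogvol dH mulmx0 mxtrace0 mulr0.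
have dw : dwup X = W^T *m h *m Z *m cogram by rewrite /dwup dK mulmx0 addr0 dwlow_z.
have ds : dsgoth X = 2 * \tr (W^T *m h *m Z *m wup^T).
  rewrite dsgoth_z /wperp; move: wup => w; rewrite !mxdistr.
  by rewrite -(mulmxA w) -(mulmxA w) nZ mulmx0 mul0mx mxtrace0 subr0.
have dwT : (W^T *m h *m Z *m cogram)^T = cogram *m Z^T *m h *m W.
  by rewrite !trmx_mul cogram_sym hT trmxK !mulmxA.
rewrite /dmomentum dl dwnorm_z ds dK /dwperp dw dwT /=.
move: wperp wup cogram => y w K.
rewrite !(mxdistr, mulmx0, mul0mx, oppr0, sub0r, mulr0, scale0r, add0r, addr0).
by apply/matrixP => i j; rewrite !mxentry; ring.
Qed.
End ImmersionVariation.

(** Infinitesimal form of the change of parameters F(z A) = det A F(z), det A > 0, whose z-gradient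
    satisfies F_z(z A) = det A F_z(z) A^{-T}; take A = 1 + t C. *)
Lemma dmomentum_tangent (C : 'M[R]_n) :
  dmomentum (0, 0, z *m C) = \tr C *: momentum - momentum *m C^T.
Proof.
set X := (0, 0, z *m C).
have dK : dcogram X = - (cogram *m C^T + C *m cogram).
  have e : dgram X = C^T *m gram + gram *m C by rewrite dgram_z trmx_mul /gram !mulmxA.
  rewrite /dcogram e mulmxDr mulmxDl (mulmxA cogram gram) mulVgram mul1mx.
  by rewrite -(mulmxA cogram) -(mulmxA C^T) mulgramV mulmx1.
have dl : dlogvol X = \tr C.
  have e : cogram *m z^T *m h *m (z *m C) = cogram *m gram *m C by rewrite /gram !mulmxA.
  by rewrite dlogvol_z e mulVgram mul1mx.
have ds : dsgoth X = 0.
  by rewrite dsgoth_z !mulmxA wperp_normal_tr !mul0mx mxtrace0 mulr0.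
have dw : dwup X = - (wup *m C^T).
  rewrite /dwup dK dwlow_z !mulmxA -/wlow mulmxN mulmxDr !mulmxA -/wup opprD.
  by rewrite addrC addrNK.
have dy : dwperp X = 0.
  rewrite /dwperp dw /= trmxN (trmx_mul wup) trmxK mulmxN mulmxA subrr; exact: subrr.
rewrite /dmomentum dl ds dw dy dK dwnorm_z /momentum /=.
move: wperp wup cogram => y w K.
rewrite !(mxdistr, mulmx0, mul0mx, oppr0, sub0r, mulr0, scale0r, add0r, addr0, subr0).
by apply/matrixP => i j; rewrite !mxentry; ring.
Qed.

(** The z-Hessian of F in terms of the tangential parts A, A' and the contractions b, b' with the
    normal part of W, chosen so that its symmetry reduces to transposing traces and permuting them
    cyclically. *)
Lemma dmomentum_pairing Z Z' :
  let A := z^T *m h *m Z in let A' := z^T *m h *m Z' in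
  let b := wperp^T *m h *m Z in let b' := wperp^T *m h *m Z' in
  \tr ((dmomentum (0, 0, Z))^T *m Z') =
  \tr (cogram *m A) * (2 * r1 * \tr (wup^T *m b') + r * \tr (cogram *m A'))
  + 4 * r2 * \tr (wup^T *m b) * \tr (wup^T *m b')
  + 2 * r1 * (- \tr (wup^T *m wup *m (Z^T *m h *m Z')) - \tr (wup^T *m b *m cogram *m A')
       + \tr (wup^T *m wup *m A^T *m cogram *m A') + \tr (cogram *m b^T *m b')
       - \tr (cogram *m A *m wup^T *m b'))
  + 2 * r1 * \tr (wup^T *m b) * \tr (cogram *m A')
  + r * (\tr (cogram *m (Z^T *m h *m Z')) - \tr (cogram *m A^T *m cogram *m A')
         - \tr (cogram *m A *m cogram *m A')).
Proof.
move=> A A' b b'.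
have dg : dgram (0, 0, Z) = A^T + A by rewrite dgram_z /A !trmx_mul trmxK hT mulmxA.
have dK : dcogram (0, 0, Z) = - (cogram *m (A^T + A) *m cogram) by rewrite /dcogram dg.
have dw : dwup (0, 0, Z) = (b - wup *m A^T) *m cogram.
  rewrite /dwup dK dwlow_z mulmxN !mulmxA -/wup -mulmxBl mulmxDr; congr (_ *m _).
  rewrite /b /A /wperp; move: wup => w; rewrite !mxdistr hT.
  by apply/matrixP => i j; rewrite !mxentry; ring.
have S : dsgoth (0, 0, Z) = 2 * \tr (wup^T *m b) by rewrite dsgoth_z -/b mxtrace_mulC.
have L : dlogvol (0, 0, Z) = \tr (cogram *m A) by rewrite dlogvol_z /A !mulmxA.
have bT : b^T = Z^T *m h *m wperp by rewrite /b !trmx_mul trmxK hT mulmxA.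
have AT : A^T = Z^T *m h *m z by rewrite /A !trmx_mul trmxK hT mulmxA.
rewrite /dmomentum /dwperp dw dK S L dwnorm_z /momentum /=.
rewrite AT bT.
rewrite mulr0 subr0 /b /b' /A /A'; have := cogram_sym.
move: (\tr (wup^T *m (wperp^T *m h *m Z))) (\tr (cogram *m (z^T *m h *m Z))) => a1 a2.
move: wperp wup cogram => y w K KT.
rewrite !(mxdistr, mul0mx, add0r, mulmx0, trmx0, mxtrace0) hT KT.
ring.
Qed.

(** In the mean curvature form the Hessian of f is contracted with the inner derivative in z and the
    free index sits on the outer one; this symmetry lets the Hessian of f be the direction of
    variation instead. *)
Lemma dmomentum_sym Z Z' :
  \tr ((dmomentum (0, 0, Z))^T *m Z') = \tr ((dmomentum (0, 0, Z'))^T *m Z).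
Proof.
rewrite !dmomentum_pairing; have := cogram_sym.
have : (Z'^T *m h *m Z)^T = Z^T *m h *m Z' by rewrite !trmx_mul trmxK hT mulmxA.
move: (z^T *m h *m Z) (z^T *m h *m Z') (wperp^T *m h *m Z) (wperp^T *m h *m Z').
move: (Z^T *m h *m Z') (Z'^T *m h *m Z) wup cogram => Q Q' w K A A' b b' QT KT.
have -> : \tr (w^T *m w *m Q') = \tr (w^T *m w *m Q).
  by rewrite -QT -(mxtrace_tr (w^T *m w *m Q'^T)) !trmx_mul !trmxK mxtrace_mulC.
have -> : \tr (w^T *m b' *m K *m A) = \tr (K *m A *m w^T *m b').
  by rewrite -(mulmxA (w^T *m b')) mxtrace_mulC !mulmxA.
have -> : \tr (w^T *m b *m K *m A') = \tr (K *m A' *m w^T *m b).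
  by rewrite -(mulmxA (w^T *m b)) mxtrace_mulC !mulmxA.
have -> : \tr (w^T *m w *m A'^T *m K *m A) = \tr (w^T *m w *m A^T *m K *m A').
  rewrite -(mxtrace_tr (w^T *m w *m A'^T *m K *m A)) !trmx_mul !trmxK KT.
  by rewrite (mulmxA K) (mulmxA A^T) mxtrace_mulC !mulmxA.
have -> : \tr (K *m b'^T *m b) = \tr (K *m b^T *m b').
  by rewrite -(mxtrace_tr (K *m b'^T *m b)) !trmx_mul trmxK KT mulmxA mxtrace_mulC mulmxA.
have -> : \tr (K *m Q') = \tr (K *m Q).
  by rewrite -QT -(mxtrace_tr (K *m Q'^T)) trmx_mul trmxK KT mxtrace_mulC.
have -> : \tr (K *m A'^T *m K *m A) = \tr (K *m A^T *m K *m A').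
  rewrite -(mxtrace_tr (K *m A'^T *m K *m A)) !trmx_mul trmxK KT.
  by rewrite (mulmxA K) (mulmxA A^T) mxtrace_mulC !mulmxA.
have -> : \tr (K *m A' *m K *m A) = \tr (K *m A *m K *m A').
  by rewrite -(mulmxA (K *m A')) mxtrace_mulC !mulmxA.
ring.
Qed.

Lemma dwnorm_w V : dwnorm (0, V, 0) = 2 * \tr (W^T *m h *m V).
Proof.
rewrite /dwnorm /= -(mxtrace_tr (V^T *m h *m W)) !trmx_mul hT trmxK mulmx0 mul0mx mxtrace0.
by rewrite !mulmxA; ring.
Qed.

Lemma dgram_w V : dgram (0, V, 0) = 0.
Proof. by rewrite /dgram /= !(trmx0, mulmx0, mul0mx, addr0). Qed.

Lemma dwlow_w V : dwlow (0, V, 0) = V^T *m h *m z.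
Proof. by rewrite /dwlow /= !(trmx0, mulmx0, mul0mx, addr0). Qed.

(** Since s = 1 - |W^perp|^2, moving W by V changes s through the normal part of V alone. *)
Lemma dsgoth_w V : dsgoth (0, V, 0) = - 2 * \tr (wperp^T *m h *m V).
Proof.
rewrite dsgothE dwnorm_w dgram_w dwlow_w mulmx0 mul0mx mxtrace0 subr0.
rewrite -(mxtrace_tr (V^T *m h *m z *m wup^T)) /wperp; move: wup => w.
by rewrite !mxdistr hT; ring.
Qed.

Lemma dlogvol_w V : dlogvol (0, V, 0) = 0.
Proof. by rewrite /dlogvol dgram_w mulmx0 mxtrace0 mulr0. Qed.

Lemma dlagr_w V : dlagr (0, V, 0) =
  - 2 * r1 * \tr (wperp^T *m h *m V) - 2 * r * lc * \tr (W^T *m h *m V).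
Proof. by rewrite /dlagr dsgoth_w dlogvol_w dwnorm_w; ring. Qed.

Lemma dmomentum_w V : dmomentum (0, V, 0) =
    (- 2 * lc * \tr (W^T *m h *m V)) *: momentum
  + (- 4 * r2 * \tr (wperp^T *m h *m V)) *: (h *m wperp *m wup)
  + (2 * r1) *: (h *m V *m wup - h *m z *m cogram *m z^T *m h *m V *m wup
                  + h *m wperp *m V^T *m h *m z *m cogram)
  + (- 2 * r1 * \tr (wperp^T *m h *m V)) *: (h *m z *m cogram).
Proof.
have dK : dcogram (0, V, 0) = 0 by rewrite /dcogram dgram_w mulmx0 mul0mx oppr0.
rewrite /dmomentum dlogvol_w dsgoth_w dwnorm_w /dwperp /dwup dK dwlow_w /=.
have dwT : (V^T *m h *m z *m cogram)^T = cogram *m z^T *m h *m V.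
  by rewrite !trmx_mul cogram_sym hT trmxK !mulmxA.
rewrite mulmx0 addr0 dwT; move: momentum => M.
move: (\tr _) (\tr _) => a b.
move: wperp wup cogram => y w K.
rewrite !(mxdistr, mulmx0, mul0mx, oppr0, sub0r, mulr0, scale0r, scaler0, add0r, addr0, subr0).
by apply/matrixP => i j; rewrite !mxentry; ring.
Qed.
End Variation.

(** * Derivatives along curves of matrices *)

Section ScalarDerivatives.
Variable R : realType.
Implicit Types (f g : R -> R) (t a b : R).

Lemma is_derive_cts {f t a} : is_derive t 1 f a -> {for t, continuous f}.
Proof. by move=> [df _]; apply/differentiable_continuous/derivable1_diffP. Qed.

Lemma is_derive1_unique {f t a b} : is_derive t 1 f a -> is_derive t 1 f b -> a = b.
Proof. by move=> [_ <-] [_ <-]. Qed.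

Lemma is_derive_derive1 {f t a} : is_derive t 1 f a -> derive1 f t = a.
Proof. by move=> [_ <-]; rewrite derive1E. Qed.

Lemma derivable_is_derive1 {f t} : derivable f t 1 -> is_derive t 1 f (derive1 f t).
Proof. by move=> df; rewrite derive1E; apply: derivableP. Qed.

Lemma ider_cst t (c : R) : is_derive t 1 (fun _ : R => c) (0 : R).
Proof. exact: is_derive_cst. Qed.

Lemma ider_add f g t a b : is_derive t 1 f a -> is_derive t 1 g b ->
  is_derive t 1 (fun s => f s + g s) (a + b).
Proof. exact: is_deriveD. Qed.

Lemma ider_opp f t a : is_derive t 1 f a -> is_derive t 1 (fun s => - f s) (- a).
Proof. exact: is_deriveN. Qed.

Lemma ider_mul f g t a b : is_derive t 1 f a -> is_derive t 1 g b ->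
  is_derive t 1 (fun s => f s * g s) (a * g t + f t * b).
Proof.
move=> fa gb; apply: is_derive_eq (is_deriveM _ _) _.
by rewrite /GRing.scale /= addrC [g t * a]mulrC.
Qed.

Lemma ider_inv f t a : is_derive t 1 f a -> f t != 0 ->
  is_derive t 1 (fun s => (f s)^-1) (- (f t)^-2 * a).
Proof. by move=> fa f0; apply: is_deriveV. Qed.

Lemma ider_comp f g t a b : is_derive (g t) 1 f a -> is_derive t 1 g b ->
  is_derive t 1 (fun s => f (g s)) (a * b).
Proof. exact: is_derive1_comp. Qed.

Lemma ider_sum (I : Type) (r : seq I) (P : pred I) (F : I -> R -> R) (dF : I -> R) t :
  (forall i, is_derive t 1 (F i) (dF i)) ->
  is_derive t 1 (fun s => \sum_(i <- r | P i) F i s) (\sum_(i <- r | P i) dF i).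
Proof.
move=> dFi; elim: r => [|i r IH].
  by under eq_fun do rewrite big_nil; rewrite big_nil; exact: ider_cst.
under eq_fun do rewrite big_cons; rewrite big_cons.
by case: (P i) => //; apply: ider_add.
Qed.

(** Without repetitions in [r], the filter [j != i] removes exactly the differentiated factor. *)
Lemma ider_prod (I : eqType) (r : seq I) (F : I -> R -> R) (dF : I -> R) t :
  uniq r -> (forall i, is_derive t 1 (F i) (dF i)) ->
  is_derive t 1 (fun s => \prod_(i <- r) F i s)
    (\sum_(i <- r) dF i * \prod_(j <- r | j != i) F j t).
Proof.
move=> + dFi; elim: r => [_|i r IH /= /andP[ir ur]].
  by under eq_fun do rewrite big_nil; rewrite big_nil; exact: ider_cst.
under eq_fun do rewrite big_cons.
apply: is_derive_eq (ider_mul (dFi i) (IH ur)) _.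
rewrite [RHS]big_cons big_cons eqxx /=; congr (_ * _ + _).
  rewrite big_seq [RHS]big_seq_cond; apply: eq_bigl => j.
  by case jr: (j \in r) => //=; apply/esym/negP => /eqP ji; rewrite -ji jr in ir.
rewrite mulr_sumr; apply: eq_big_seq => j jr.
rewrite big_cons ifT; first by rewrite mulrCA.
by apply/negP => /eqP ij; rewrite ij jr in ir.
Qed.
End ScalarDerivatives.

Section MatrixCurves.
Variable R : realType.
Implicit Types (t : R).

(** Entrywise, and with [is_derive] rather than [derive1], so that derivability and the value of the
    derivative travel together. *)
Definition mxder {m n} (A : R -> 'M[R]_(m, n)) (t : R) (dA : 'M[R]_(m, n)) :=
  forall i j, is_derive t 1 (fun s => A s i j) (dA i j).

Lemma mxder_eq m n (A : R -> 'M[R]_(m, n)) t B C : mxder A t B -> B = C -> mxder A t C.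
Proof. by move=> AB <-. Qed.

Lemma mxder_cst m n (A : 'M[R]_(m, n)) t : mxder (fun=> A) t 0.
Proof. by move=> i j; rewrite mxE; apply: ider_cst. Qed.

Lemma mxder_unique m n (A : R -> 'M[R]_(m, n)) t B C :
  mxder A t B -> mxder A t C -> B = C.
Proof.
by move=> AB AC; apply/matrixP => i j; apply: is_derive1_unique (AB i j) (AC i j).
Qed.

Lemma mxder_near m n (A B : R -> 'M[R]_(m, n)) t C :
  (\forall s \near t, A s = B s) -> mxder A t C -> mxder B t C.
Proof.
move=> AB AC i j; apply: near_eq_is_derive (AC i j).
by near=> s; have -> : A s = B s by near: s.
Unshelve. all: by end_near. Qed.

Lemma mxderD m n (A B : R -> 'M[R]_(m, n)) t A' B' : mxder A t A' -> mxder B t B' ->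
  mxder (fun s => A s + B s) t (A' + B').
Proof.
move=> AA BB i j; rewrite mxE; under eq_fun do rewrite mxE; exact: ider_add.
Qed.

Lemma mxderN m n (A : R -> 'M[R]_(m, n)) t A' : mxder A t A' ->
  mxder (fun s => - A s) t (- A').
Proof.
move=> AA i j; rewrite mxE; under eq_fun do rewrite mxE; exact: ider_opp.
Qed.

Lemma mxderZ m n (a : R -> R) (A : R -> 'M[R]_(m, n)) t (a' : R) A' : is_derive t 1 a a' ->
  mxder A t A' -> mxder (fun s => a s *: A s) t (a' *: A t + a t *: A').
Proof.
move=> aa AA i j; rewrite !mxE; under eq_fun do rewrite mxE; exact: ider_mul.
Qed.

Lemma mxderT m n (A : R -> 'M[R]_(m, n)) t A' : mxder A t A' ->
  mxder (fun s => (A s)^T) t A'^T.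
Proof. by move=> AA i j; rewrite mxE; under eq_fun do rewrite mxE; exact: AA. Qed.

Lemma mxderM m n k (A : R -> 'M[R]_(m, n)) (B : R -> 'M[R]_(n, k)) t A' B' :
  mxder A t A' -> mxder B t B' ->
  mxder (fun s => A s *m B s) t (A' *m B t + A t *m B').
Proof.
move=> AA BB i j; rewrite !mxE -big_split /=; under eq_fun do rewrite mxE.
by apply: ider_sum => l; apply: ider_mul.
Qed.

Lemma ider_trace n (A : R -> 'M[R]_n) t A' : mxder A t A' ->
  is_derive t 1 (fun s => \tr (A s)) (\tr A').
Proof. by move=> AA; apply: ider_sum => i. Qed.

Lemma ider_det n (A : R -> 'M[R]_n) t A' : mxder A t A' ->
  is_derive t 1 (fun s => \det (A s)) (\tr (\adj (A t) *m A')).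
Proof.
move=> AA; rewrite /determinant.
(* [B k] is [A t] with row k taken from [A']. Expanding its determinant along that row gives the
   adjugate, expanding over permutations gives the product rule; the summand [0 * _] is the shape
   that [ider_mul] produces for the constant sign. *)
pose B k : 'M[R]_n := \matrix_(i, j) if i == k then A' i j else A t i j.
have -> : \tr (\adj (A t) *m A') = \sum_(s : 'S_n) (0 * \prod_i A t i (s i) + (-1) ^+ s *
   \sum_k A' k (s k) * \prod_(j | j != k) A t j (s j)).
  transitivity (\sum_k \det (B k)).
    rewrite mxtrace_mulC; apply: eq_bigr => k _.
    rewrite (expand_det_row _ k) mxE; apply: eq_bigr => j _.
    rewrite !mxE eqxx; congr (_ * (_ * \det _)).
    by apply/matrixP => a b; rewrite !mxE eq_sym (negbTE (neq_lift _ _)).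
  rewrite exchange_big /=; apply: eq_bigr => s _.
  rewrite mul0r add0r mulr_sumr; apply: eq_bigr => k _; congr (_ * _).
  rewrite (bigD1 k) //= mxE eqxx; congr (_ * _); apply: eq_bigr => j jk.
  by rewrite mxE (negbTE jk).
apply: ider_sum => s; apply: ider_mul (ider_cst _ _) _.
by apply: (@ider_prod _ _ _ (fun i u => A u i (s i)) (fun i => A' i (s i))) => //; exact: index_enum_uniq.
Qed.

Lemma mxder_inv n (A : R -> 'M[R]_n) t A' : A t \in unitmx -> mxder A t A' ->
  mxder (fun s => invmx (A s)) t (- (invmx (A t) *m A' *m invmx (A t))).
Proof.
move=> At AA.
have At0 : \det (A t) != 0 by move: At; rewrite unitmxE unitfE.
have dd := ider_det AA.
have near_unit : \forall s \near t, A s \in unitmx.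
  near=> s; rewrite unitmxE unitfE; near: s.
  by apply: cvgr_neq0 At0; exact: is_derive_cts dd.
(* Existence first, by Cramer's formula. It describes [invmx] only at invertible matrices, since
   [invmx] returns a singular matrix unchanged, hence [near_unit]. The value then follows by
   differentiating A A^{-1} = 1. *)
have [D AD] : exists D, mxder (fun s => invmx (A s)) t D.
  have dcof i j : derivable (fun s => (\det (A s))^-1 * cofactor (A s) j i) t 1.
    have dmin : mxder (fun s => row' j (col' i (A s))) t (row' j (col' i A')).
      by move=> a b; rewrite !mxE; under eq_fun do rewrite !mxE; exact: AA.
    have dc := ider_mul (ider_cst t ((-1) ^+ (j + i))) (ider_det dmin).
    by have [] := ider_mul (ider_inv dd At0) dc.
  exists (\matrix_(i, j) derive1 (fun s => (\det (A s))^-1 * cofactor (A s) j i) t) => i j.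
  rewrite mxE; apply: near_eq_is_derive (derivable_is_derive1 (dcof i j)).
  near=> s; have As : A s \in unitmx by near: s.
  by rewrite /invmx As !mxE.
apply: mxder_eq (AD) _.
have A1 : mxder (fun s => A s *m invmx (A s)) t 0.
  apply: mxder_near (mxder_cst 1%:M t); near=> s; rewrite mulmxV //; near: s; exact: near_unit.
have /eqP := mxder_unique A1 (mxderM AA AD).
rewrite eq_sym addr_eq0 => /eqP e.
by rewrite -mulmxA e mulmxN opprK mulKmx.
Unshelve. all: by end_near. Qed.
End MatrixCurves.

(** * The functions rho and chi, and the derivative of the density along a curve *)

Section VolumeDensity.
Variable R : realType.
Implicit Types (v : volume) (n : nat) (s w t : R).

Lemma near_pos s : 0 < s -> \forall u \near s, 0 < u.
Proof. exact: lt_nbhsr. Qed.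

Lemma ider_sqrt s : 0 < s -> is_derive s 1 Num.sqrt ((2 * Num.sqrt s)^-1).
Proof. by move=> s0; apply: is_derive1_sqrt. Qed.

Lemma ider_exp (f : R -> R) n t a : is_derive t 1 f a ->
  is_derive t 1 (fun s => f s ^+ n) (n%:R * f t ^+ n.-1 * a).
Proof. by move=> fa; have := is_deriveX n fa; rewrite exprfctE. Qed.

(** A closed form that can be differentiated once more; it agrees with [rho'] on s > 0, which
    suffices near a positive point. *)
Definition rho1 v n s : R :=
  match v with
  | BH => - ((Num.sqrt s ^+ n) ^- 2) * (n%:R * Num.sqrt s ^+ n.-1 * (2 * Num.sqrt s)^-1)
  | HT => (2 * Num.sqrt s)^-1
  end.

Lemma ider_rho_explicit v n s : 0 < s -> is_derive s 1 (rho v n) (rho1 v n s).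
Proof.
move=> s0; case: v => /=; last exact: ider_sqrt.
apply: ider_inv; first by apply: ider_exp; exact: ider_sqrt.
by rewrite expf_neq0 // gt_eqF // sqrtr_gt0.
Qed.

Lemma ider_rho v n s : 0 < s -> is_derive s 1 (rho v n) (rho' v n s).
Proof.
by move=> s0; apply: derivable_is_derive1; have [] := ider_rho_explicit v n s0.
Qed.

Lemma ider_rho' v n s : 0 < s -> is_derive s 1 (rho' v n) (rho'' v n s).
Proof.
move=> s0; apply: derivable_is_derive1.
have sq0 : 2 * Num.sqrt s != 0 by rewrite mulf_neq0 // gt_eqF // sqrtr_gt0.
have sqn0 m : Num.sqrt s ^+ m != 0 by rewrite expf_neq0 // gt_eqF // sqrtr_gt0.
have d2 := ider_inv (ider_mul (ider_cst s 2) (ider_sqrt s0)) sq0.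
have : derivable (rho1 v n) s 1.
  case: v => /=; last by have [] := d2.
  have di := ider_opp (ider_inv (ider_exp 2 (ider_exp n (ider_sqrt s0)))
     (expf_neq0 2 (sqn0 n))).
  by have [] := ider_mul di (ider_mul
     (ider_mul (ider_cst s n%:R) (ider_exp n.-1 (ider_sqrt s0))) d2).
apply: near_eq_derivable.
near=> u; rewrite /rho' (is_derive_derive1 (ider_rho_explicit v n _)) //.
by near: u; exact: near_pos.
Unshelve. all: by end_near. Qed.

Lemma chi_gt0 v n w : w < 1 -> 0 < chi v n w.
Proof.
by move=> w1; case: v => //=; rewrite exprn_gt0 // sqrtr_gt0 subr_gt0.
Qed.

(** The logarithmic form lets the volume factor be differentiated as itself times a scalar, which is
    then divided out. *)
Lemma ider_chi v n w : w < 1 -> is_derive w 1 (chi v n) (chi v n w * logchi' v n w).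
Proof.
move=> w1.
have [d dd] : exists d, is_derive w 1 (chi v n) d.
  case: v => /=; first by eexists; exact: ider_cst.
  have w0 : 0 < 1 - w by rewrite subr_gt0.
  have d1 := ider_add (ider_cst w 1) (ider_opp (is_derive_id w 1)).
  have d2 := ider_exp n.+1 (ider_comp (g := fun u => 1 - u) (ider_sqrt w0) d1).
  by eexists; exact: d2.
have c0 := chi_gt0 v n w1.
rewrite /logchi' (is_derive_derive1 (ider_comp (is_derive1_ln c0) dd)).
by rewrite mulrA divff ?mul1r // gt_eqF.
Qed.
End VolumeDensity.

Section LagrangianDerivative.
Variables (R : realType) (N n : nat) (v : volume).

Definition vol (h : 'M[R]_N) (W : 'cV[R]_N) (z : 'M[R]_(N, n)) : R :=
  Num.sqrt (\det (gram h z)) / chi v n (wnorm h W).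

Definition lagr (h : 'M[R]_N) (W : 'cV[R]_N) (z : 'M[R]_(N, n)) : R :=
  rho v n (sgoth h W z) * vol h W z.

Definition grad (h : 'M[R]_N) (W : 'cV[R]_N) (z : 'M[R]_(N, n)) : 'M[R]_(N, n) :=
  vol h W z *: momentum h W z (rho v n (sgoth h W z)) (rho' v n (sgoth h W z)).

(** Open conditions under which both square roots, the inverse Gram matrix and 1 / chi are
    differentiable. *)
Definition regular (h : 'M[R]_N) (W : 'cV[R]_N) (z : 'M[R]_(N, n)) :=
  [/\ 0 < \det (gram h z), 0 < sgoth h W z & wnorm h W < 1].

Variables (h : R -> 'M[R]_N) (W : R -> 'cV[R]_N) (z : R -> 'M[R]_(N, n)).
Variables (t : R) (X : tangent R N n).
Hypothesis dh : mxder h t X.1.1.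
Hypothesis dW : mxder W t X.1.2.
Hypothesis dz : mxder z t X.2.

Let mxder_gram : mxder (fun s => gram (h s) (z s)) t (dgram (h t) (z t) X).
Proof.
by apply: mxder_eq (mxderM (mxderM (mxderT dz) dh) dz) _; rewrite mulmxDl.
Qed.

Let mxder_wlow : mxder (fun s => wlow (h s) (W s) (z s)) t (dwlow (h t) (W t) (z t) X).
Proof.
by apply: mxder_eq (mxderM (mxderM (mxderT dW) dh) dz) _; rewrite mulmxDl.
Qed.

Let ider_wnorm : is_derive t 1 (fun s => wnorm (h s) (W s)) (dwnorm (h t) (W t) X).
Proof.
apply: is_derive_eq (ider_trace (mxderM (mxderM (mxderT dW) dh) dW)) _.
by rewrite mulmxDl !mxtraceD.
Qed.

Hypothesis reg : regular (h t) (W t) (z t).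

Let gram_unit : gram (h t) (z t) \in unitmx.
Proof. by case: reg => d0 _ _; rewrite unitmxE unitfE gt_eqF. Qed.

Let mxder_cogram : mxder (fun s => cogram (h s) (z s)) t (dcogram (h t) (z t) X).
Proof. exact: mxder_inv. Qed.

Let mxder_wup : mxder (fun s => wup (h s) (W s) (z s)) t (dwup (h t) (W t) (z t) X).
Proof. exact: mxderM. Qed.

Let mxder_wperp : mxder (fun s => wperp (h s) (W s) (z s)) t (dwperp (h t) (W t) (z t) X).
Proof. exact: mxderD (mxderN (mxderM _ (mxderT _))). Qed.

Let ider_sgoth :
  is_derive t 1 (fun s => sgoth (h s) (W s) (z s)) (dsgoth (h t) (W t) (z t) X).
Proof.
apply: is_derive_eq (ider_add (ider_add (ider_cst t 1) (ider_opp ider_wnorm))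
  (ider_trace (mxderM mxder_wup (mxderT mxder_wlow)))) _.
by rewrite add0r mxtraceD.
Qed.

Let ider_vol : is_derive t 1 (fun s => vol (h s) (W s) (z s))
  (vol (h t) (W t) (z t) * (dlogvol (h t) (z t) X -
     logchi' v n (wnorm (h t) (W t)) * dwnorm (h t) (W t) X)).
Proof.
case: reg => d0 _ w1; have c0 := chi_gt0 v n w1.
have c0' : chi v n (wnorm (h t) (W t)) != 0 by rewrite gt_eqF.
have dsq := ider_comp (ider_sqrt d0) (ider_det mxder_gram).
have dchi := ider_inv (ider_comp (ider_chi v n w1) ider_wnorm) c0'.
apply: is_derive_eq (ider_mul dsq dchi) _.
have -> : \adj (gram (h t) (z t)) = \det (gram (h t) (z t)) *: cogram (h t) (z t).
  by rewrite /cogram /invmx gram_unit scalerA mulfV ?scale1r // gt_eqF.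
rewrite -scalemxAl mxtraceZ /vol /dlogvol.
have q0 : Num.sqrt (\det (gram (h t) (z t))) != 0 by rewrite gt_eqF // sqrtr_gt0.
(* The determinant is written as the square of its root, so that [field] meets a single unknown
   [q]. *)
rewrite -{2}(sqr_sqrtr (ltW d0)).
move: (Num.sqrt _) (chi _ _ _) q0 c0' (\tr _) (logchi' _ _ _) (dwnorm _ _ _) => q c q0 c0' a l w.
by field; rewrite q0 c0'.
Qed.

Lemma ider_lagr : is_derive t 1 (fun s => lagr (h s) (W s) (z s))
  (vol (h t) (W t) (z t) * dlagr (h t) (W t) (z t)
     (rho v n (sgoth (h t) (W t) (z t))) (rho' v n (sgoth (h t) (W t) (z t)))
     (logchi' v n (wnorm (h t) (W t))) X).
Proof.
case: reg => _ s0 _.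
have d := ider_mul (ider_comp (g := fun s => sgoth (h s) (W s) (z s)) (ider_rho v n s0) ider_sgoth) ider_vol.
apply: is_derive_eq d _.
by rewrite /dlagr; ring.
Qed.

Lemma mxder_grad : mxder (fun s => grad (h s) (W s) (z s)) t
  (vol (h t) (W t) (z t) *: dmomentum (h t) (W t) (z t)
     (rho v n (sgoth (h t) (W t) (z t))) (rho' v n (sgoth (h t) (W t) (z t)))
     (rho'' v n (sgoth (h t) (W t) (z t)))
     (logchi' v n (wnorm (h t) (W t))) X).
Proof.
case: reg => _ s0 _.
have dr := ider_comp (g := fun s => sgoth (h s) (W s) (z s)) (ider_rho v n s0) ider_sgoth.
have dr' := ider_mul (ider_cst t 2) (ider_comp (g := fun s => sgoth (h s) (W s) (z s)) (ider_rho' v n s0) ider_sgoth).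
apply: mxder_eq (mxderZ ider_vol (mxderD
  (mxderZ dr' (mxderM (mxderM dh mxder_wperp) mxder_wup))
  (mxderZ dr (mxderM (mxderM dh dz) mxder_cogram)))) _.
rewrite mul0r add0r /dmomentum -[in RHS]addrA [in RHS]scalerDr scalerA.
by congr (_ *: _ + _).
Qed.

(** A second derivative differentiates a first one, which equals [grad] at regular points; openness
    makes this an equality near t. *)
Lemma near_regular : \forall s \near t, regular (h s) (W s) (z s).
Proof.
case: reg => d0 s0 w1; near=> s; split; near: s.
- by apply: cvgr_gt d0; exact: is_derive_cts (ider_det mxder_gram).
- by apply: cvgr_gt s0; exact: is_derive_cts ider_sgoth.
- by apply: cvgr_lt w1; exact: is_derive_cts ider_wnorm.
Unshelve. all: by end_near. Qed.
End LagrangianDerivative.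

(** * Positive definiteness implies regularity *)

Section PositiveDefinite.
Variable R : realType.

Definition posdef m (A : 'M[R]_m) := forall u : 'rV[R]_m, u != 0 -> 0 < (u *m A *m u^T) 0 0.

(** Along the segment from the identity to A the determinant starts at 1; were it nonpositive at A,
    some matrix of the segment would be singular, but a convex combination of positive definite
    matrices has no kernel. *)
Lemma posdef_det m (A : 'M[R]_m) : posdef A -> 0 < \det A.
Proof.
move=> pA; rewrite ltNge; apply/negP => dA.
pose M (t : R) : 'M[R]_m := (1 - t) *: 1%:M + t *: A.
have M' t : mxder M t (-1 *: 1%:M + 1 *: A).
  have d1 : is_derive t 1 (fun u : R => 1 - u) (-1).
    by apply: is_derive_eq (ider_add (ider_cst t 1) (ider_opp (is_derive_id t 1))) _; rewrite add0r.
  have dt : is_derive t 1 (fun u : R => u) 1 by exact: is_derive_id.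
  apply: mxder_eq (mxderD (mxderZ d1 (mxder_cst 1%:M t)) (mxderZ dt (mxder_cst A t))) _.
  by rewrite !scaler0 !addr0.
have Mc : continuous (fun t => \det (M t)).
  by move=> t; apply: is_derive_cts (ider_det (M' t)).
have M0 : \det (M 0) = 1 by rewrite /M subr0 scale1r scale0r addr0 det1.
have M1 : \det (M 1) = \det A by rewrite /M subrr scale1r scale0r add0r.
have [| |c] := @IVT R (fun t => \det (M t)) 0 1 0 ler01.
- exact: continuous_subspaceT.
- by rewrite M0 M1 ge_min le_max dA ler01 orbT.
rewrite in_itv /= => /andP[c0 c1] /eqP/det0P[u u0 uM].
suff : 0 < (u *m M c *m u^T) 0 0 by rewrite uM mul0mx mxE ltxx.
have uu : 0 < (u *m u^T) 0 0.
  rewrite mxE lt_def sumr_ge0 ?andbT; last by move=> i _; rewrite mxE -expr2 sqr_ge0.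
  apply: contra u0 => /eqP e; apply/eqP/rowP => i; rewrite mxE.
  have /eqP : u 0 i * u^T i 0 = 0.
    by apply: (psumr_eq0P _ e) => // j _; rewrite mxE -expr2 sqr_ge0.
  by rewrite mxE mulf_eq0 orbb => /eqP.
rewrite /M mulmxDr mulmxDl -!scalemxAr -!scalemxAl mulmx1 !mxE.
have uA := pA u u0; move: uu uA; rewrite !mxE => uu uA.
move: c0; rewrite le_eqVlt => /orP[/eqP <-|c0].
  by rewrite subr0 mul1r mul0r addr0.
by rewrite ltr_wpDl // ?mulr_gt0 // mulr_ge0 ?subr_ge0 // ltW.
Qed.

Lemma gram_posdef N n (h : 'M[R]_N) (z : 'M[R]_(N, n)) :
  posdef h -> \rank z = n -> posdef (gram h z).
Proof.
move=> ph rz u u0.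
have := ph (u *m z^T); rewrite trmx_mul trmxK !mulmxA; apply.
apply: contra u0 => /eqP e; have zf : row_free z^T by rewrite /row_free mxrank_tr rz.
by apply/eqP/(row_free_inj zf); rewrite mul0mx.
Qed.

(** s exceeds 1 - |W|^2 by the squared norm of the tangential part of W, a value of the positive
    definite form [gram]. *)
Lemma posdef_regular N n (h : 'M[R]_N) (W : 'cV[R]_N) (z : 'M[R]_(N, n)) :
  h^T = h -> posdef h -> \rank z = n -> wnorm h W < 1 -> regular h W z.
Proof.
move=> hT ph rz w1; have pg := gram_posdef ph rz; have d0 := posdef_det pg.
split=> //; rewrite /sgoth ltr_pwDl ?subr_gt0 //.
have gu : gram h z \in unitmx by rewrite unitmxE unitfE gt_eqF.
have e : wlow h W z *m cogram h z *m (wlow h W z)^T = wup h W z *m gram h z *m (wup h W z)^T.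
  rewrite /wup -(mulmxA (wlow h W z) _ (gram h z)) mulVgram // mulmx1.
  by rewrite [in RHS](trmx_mul (wlow h W z)) cogram_sym // mulmxA.
rewrite e trace_mx11; have [->|/pg/ltW//] := eqVneq (wup h W z) 0.
by rewrite !mul0mx mxE.
Qed.
End PositiveDefinite.

(** * Partial derivatives of the volume density *)

Section Lines.
Variable R : realType.

Lemma mxder_line m k (A D : 'M[R]_(m, k)) : mxder (fun t => A + t *: D) 0 D.
Proof.
move=> i j; under eq_fun do rewrite !mxE.
apply: is_derive_eq (ider_add (ider_cst 0 (A i j)) (ider_mul (is_derive_id (0 : R) 1) (ider_cst 0 (D i j)))) _.
by rewrite mulr0 addr0 mul1r add0r.
Qed.

Lemma line_cvg N (x d : 'rV[R]_N) : (x + t *: d) @[t --> (0 : R)] --> x.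
Proof.
have : (x + t *: d) @[t --> (0 : R)] --> x + (0 : R) *: d.
  by apply: cvgD; [exact: cvg_cst|apply: cvgZl; exact: cvg_id].
by rewrite scale0r addr0.
Qed.

Lemma near_line N (U : set 'rV[R]_N) (x d : 'rV[R]_N) : open U -> U x ->
  \forall t \near (0 : R), U (x + t *: d).
Proof.
by move=> oU Ux; apply: (@line_cvg _ x d); apply: open_nbhs_nbhs; split.
Qed.

Lemma smooth_on_derive N (U : set 'rV[R]_N) g k x : smooth_on U g -> U x ->
  is_derive (0 : R) 1 (fun t => g (x + t *: ev R k)) (pd k g x).
Proof. by move=> sg Ux; apply: derivable_is_derive1; have [_] := sg [::] x Ux; apply. Qed.

(** The last index of the list is differentiated first, so passing from g to a partial derivative of
    g appends to the list. *)
Lemma iter_pd_rcons N (ks : seq 'I_N) k (g : 'rV[R]_N -> R) :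
  iter_pd (rcons ks k) g = iter_pd ks (pd k g).
Proof. by elim: ks => //= j ks ->. Qed.

Lemma smooth_on_pd N (U : set 'rV[R]_N) g k : smooth_on U g -> smooth_on U (pd k g).
Proof. by move=> sg ks x Ux; rewrite -iter_pd_rcons; apply: sg. Qed.
End Lines.

Section VolumeForm.
Variables (R : realType) (n p : nat) (v : volume).
Let N := (n + p)%N.
Variables (Ut : set 'rV[R]_N) (ht : 'rV[R]_N -> 'M[R]_N) (Wt : 'rV[R]_N -> 'rV[R]_N).
Hypothesis Ut_open : open Ut.
Hypothesis ht_smooth : forall a b, smooth_on Ut (fun y => ht y a b).
Hypothesis ht_sym : forall x, Ut x -> (ht x)^T = ht x.
Hypothesis ht_pos : forall x, Ut x -> posdef (ht x).
Hypothesis Wt_smooth : forall a, smooth_on Ut (fun y => Wt y 0 a).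
Hypothesis Wt_lt1 : forall x, Ut x -> Wnorm2 ht Wt x < 1.

Definition pd_ht (e : 'I_N) x : 'M[R]_N := \matrix_(a, b) pd e (fun y => ht y a b) x.
Definition pd_Wt (e : 'I_N) x : 'cV[R]_N := \col_a pd e (fun y => Wt y 0 a) x.
Definition pd_nav e x : tangent R N n := (pd_ht e x, pd_Wt e x, 0).

Lemma WlowE x a : Wlow ht Wt x a = (ht x *m (Wt x)^T) a 0.
Proof. by rewrite mxE; apply: eq_bigr => b _; rewrite mxE. Qed.

Lemma Wnorm2E x : Wnorm2 ht Wt x = wnorm (ht x) (Wt x)^T.
Proof.
rewrite /wnorm trmxK -mulmxA trace_mx11 mxE; apply: eq_bigr => a _.
by rewrite WlowE mulrC.
Qed.

Lemma wlowE x (z : 'M[R]_(N, n)) : Ut x ->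
  \row_i \sum_a Wlow ht Wt x a * z a i = wlow (ht x) (Wt x)^T z.
Proof.
move=> Ux; apply/rowP => i; rewrite /wlow trmxK !mxE; apply: eq_bigr => a _.
by rewrite WlowE -[ht x in LHS](ht_sym Ux) -trmx_mul mxE.
Qed.

Lemma Fvol_lagr x z : Ut x -> Fvol v ht Wt x z = lagr v (ht x) (Wt x)^T z.
Proof.
move=> Ux; rewrite /Fvol wlowE // Wnorm2E /lagr /vol /sgoth trace_mx11.
by rewrite -/(gram _ _) -/(cogram _ _); ring.
Qed.

Lemma nav_regular x (z : 'M[R]_(N, n)) : Ut x -> \rank z = n -> regular (ht x) (Wt x)^T z.
Proof.
move=> Ux rz; apply: posdef_regular => //; [exact: ht_sym|exact: ht_pos|].
by rewrite -Wnorm2E; exact: Wt_lt1.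
Qed.

Section FirstDerivative.
Variables (x : 'rV[R]_N) (z : 'M[R]_(N, n)).
Hypothesis Ux : Ut x.
Hypothesis reg : regular (ht x) (Wt x)^T z.

Lemma mxder_ht e : mxder (fun t => ht (x + t *: ev R e)) 0 (pd_ht e x).
Proof. by move=> a b; rewrite mxE; exact: smooth_on_derive. Qed.

Lemma mxder_Wt e : mxder (fun t => (Wt (x + t *: ev R e))^T) 0 (pd_Wt e x).
Proof.
move=> a b; rewrite mxE (ord1 b); under eq_fun do rewrite mxE.
exact: smooth_on_derive (Wt_smooth a) Ux.
Qed.

Lemma dz_Fvol e j : dz e j (Fvol v ht Wt) x z = grad v (ht x) (Wt x)^T z e j.
Proof.
rewrite /dz; apply: is_derive_derive1; under eq_fun do rewrite Fvol_lagr //.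
have := @ider_lagr R N n v (fun=> ht x) (fun=> (Wt x)^T) (fun t => z + t *: delta_mx e j) 0
  (0, 0, delta_mx e j) (mxder_cst _ _) (mxder_cst _ _) (mxder_line _ _).
rewrite scale0r addr0 => /(_ reg) d; apply: is_derive_eq d _.
rewrite dlagr_z ?ht_sym // [RHS]mxE; congr (_ * _).
exact: mxtrace_delta.
Qed.
End FirstDerivative.

Section SecondDerivatives.
Variables (x : 'rV[R]_N) (z : 'M[R]_(N, n)).
Hypothesis Ux : Ut x.
Hypothesis reg : regular (ht x) (Wt x)^T z.
Let V := vol v (ht x) (Wt x)^T z.
Let r := rho v n (sgoth (ht x) (Wt x)^T z).
Let r1 := rho' v n (sgoth (ht x) (Wt x)^T z).
Let r2 := rho'' v n (sgoth (ht x) (Wt x)^T z).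
Let lc := logchi' v n (wnorm (ht x) (Wt x)^T).

Lemma dzdz_Fvol g i e j : dz g i (dz e j (Fvol v ht Wt)) x z =
  V * dmomentum (ht x) (Wt x)^T z r r1 r2 lc (0, 0, delta_mx g i) e j.
Proof.
rewrite /dz -/(dz e j _) ; apply: is_derive_derive1.
have reg0 : regular (ht x) (Wt x)^T (z + (0 : R) *: delta_mx g i) by rewrite scale0r addr0.
have := @near_regular R N n (fun=> ht x) (fun=> (Wt x)^T) (fun t => z + t *: delta_mx g i) 0
  (0, 0, delta_mx g i) (mxder_cst _ _) (mxder_cst _ _) (mxder_line _ _) reg0.
have := @mxder_grad R N n v (fun=> ht x) (fun=> (Wt x)^T) (fun t => z + t *: delta_mx g i) 0
  (0, 0, delta_mx g i) (mxder_cst _ _) (mxder_cst _ _) (mxder_line _ _) reg0 e j.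
rewrite scale0r addr0 [X in is_derive _ _ _ X]mxE => d near_reg.
apply: near_eq_is_derive d; near=> t; rewrite -dz_Fvol //.
by near: t.
Unshelve. all: by end_near. Qed.

Lemma dxt_Fvol e : dxt e (Fvol v ht Wt) x z =
  V * dlagr (ht x) (Wt x)^T z r r1 lc (pd_nav e x).
Proof.
rewrite /dxt; apply: is_derive_derive1.
have reg0 : regular (ht (x + (0 : R) *: ev R e)) (Wt (x + (0 : R) *: ev R e))^T z.
  by rewrite scale0r addr0.
have := @ider_lagr R N n v _ _ (fun=> z) 0
  (pd_nav e x) (mxder_ht Ux e) (mxder_Wt Ux e) (mxder_cst _ _) reg0.
rewrite scale0r addr0; apply: near_eq_is_derive.
by near=> t; rewrite Fvol_lagr //; near: t; exact: near_line.
Unshelve. all: by end_near. Qed.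

Lemma dxtdz_Fvol e g i : dxt e (dz g i (Fvol v ht Wt)) x z =
  V * dmomentum (ht x) (Wt x)^T z r r1 r2 lc (pd_nav e x) g i.
Proof.
rewrite /dxt; apply: is_derive_derive1.
have reg0 : regular (ht (x + (0 : R) *: ev R e)) (Wt (x + (0 : R) *: ev R e))^T z.
  by rewrite scale0r addr0.
have := @near_regular R N n _ _ (fun=> z) 0
  (pd_nav e x) (mxder_ht Ux e) (mxder_Wt Ux e) (mxder_cst _ _) reg0.
have := @mxder_grad R N n v _ _ (fun=> z) 0
  (pd_nav e x) (mxder_ht Ux e) (mxder_Wt Ux e) (mxder_cst _ _) reg0 g i.
rewrite scale0r addr0 [X in is_derive _ _ _ X]mxE => d near_reg.
apply: near_eq_is_derive d; near=> t; rewrite -dz_Fvol //.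
  by near: t; exact: near_line.
by near: t.
Unshelve. all: by end_near. Qed.
End SecondDerivatives.
End VolumeForm.

(** * Mixed partials and the chain rule *)

Section MeanValue.
Variable R : realType.

(** Covers both signs of t, locating the intermediate point by its absolute value, because
    [first_order] uses increments of arbitrary sign. *)
Lemma mean_value0 (f df : R -> R) (t : R) :
  (forall s : R, `|s| <= `|t| -> is_derive s 1 f (df s)) ->
  exists2 c, `|c| <= `|t| & f t - f 0 = df c * t.
Proof.
move=> fd.
have fc s : `|s| <= `|t| -> {for s, continuous f} by move=> /fd; exact: is_derive_cts.
have [t0|t0] := leP 0 t.
- have tn : `|t| = t by rewrite ger0_norm.
  have sub s : s \in `[0, t] -> `|s| <= `|t|.
    by rewrite in_itv /= tn => /andP[s0 st]; rewrite ger0_norm.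
  have [| |c /sub ct ->] := @MVT_segment R f df 0 t t0; last 1 first.
  + by exists c => //; rewrite subr0.
  + by move=> s /subset_itv_oo_cc /sub /fd.
  + by apply: continuous_in_subspaceT => s; rewrite inE => /sub /fc.
- have tn : `|t| = - t by rewrite ltr0_norm.
  have sub s : s \in `[t, 0] -> `|s| <= `|t|.
    by rewrite in_itv /= tn => /andP[s0 st]; rewrite ler0_norm // lerN2.
  have [| |c /sub ct e] := @MVT_segment R f df t 0 (ltW t0); last 1 first.
  + by exists c => //; rewrite -opprB e sub0r mulrN opprK.
  + by move=> s /subset_itv_oo_cc /sub /fd.
  + by apply: continuous_in_subspaceT => s; rewrite inE => /sub /fc.
Qed.

Variables (N : nat) (U : set 'rV[R]_N).
Hypothesis U_open : open U.

(** [pd] is a derivative at parameter 0 of a line through the point; a translation of the parameter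
    moves it to any s. *)
Lemma ider_line g k (y : 'rV[R]_N) (s : R) : smooth_on U g -> U (y + s *: ev R k) ->
  is_derive s 1 (fun s => g (y + s *: ev R k)) (pd k g (y + s *: ev R k)).
Proof.
move=> sg Uy; have d := smooth_on_derive k sg Uy.
have ds : is_derive s 1 (fun u : R => u - s) 1.
  by apply: is_derive_eq (ider_add (is_derive_id s 1) (ider_cst s (- s))) _; rewrite addr0.
rewrite -[X in is_derive X _ _ _](subrr s) in d.
have := ider_comp (g := fun u => u - s) d ds; rewrite mulr1.
congr (is_derive _ _ _ _); apply/funext => u.
by rewrite -addrA -scalerDl (addrC s) subrK.
Qed.

(** The mean value theorem is applied to the j-difference of g as a function of the i-increment,
    then to [pd i g] along j. *)
Lemma second_difference g i j (x : 'rV[R]_N) (t : R) : smooth_on U g ->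
  (forall s u : R, `|s| <= `|t| -> `|u| <= `|t| -> U (x + s *: ev R i + u *: ev R j)) ->
  exists s u : R, [/\ `|s| <= `|t|, `|u| <= `|t| &
    g (x + t *: ev R i + t *: ev R j) - g (x + t *: ev R j) - (g (x + t *: ev R i) - g x)
    = pd j (pd i g) (x + s *: ev R i + u *: ev R j) * t * t].
Proof.
move=> sg Uxs.
have le0 : `|0 : R| <= `|t| by rewrite normr0.
pose f s := g (x + t *: ev R j + s *: ev R i) - g (x + s *: ev R i).
pose df s := pd i g (x + t *: ev R j + s *: ev R i) - pd i g (x + s *: ev R i).
have fd (s : R) : `|s| <= `|t| -> is_derive s 1 f (df s).
  move=> st; apply: ider_add; first by apply: ider_line => //; rewrite addrAC; apply: Uxs.
  by apply/ider_opp/ider_line => //; have := Uxs s 0 st le0; rewrite scale0r addr0.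
have [s st es] := mean_value0 fd.
have gd (u : R) : `|u| <= `|t| -> is_derive u 1 (fun u => pd i g (x + s *: ev R i + u *: ev R j))
    (pd j (pd i g) (x + s *: ev R i + u *: ev R j)).
  by move=> ut; apply: ider_line; [exact: smooth_on_pd|exact: Uxs].
have [u ut eu] := mean_value0 gd.
exists s, u; split => //; rewrite -eu scale0r addr0.
by move: es; rewrite /f /df !scale0r !addr0 ![x + t *: ev R j + _]addrAC => <-; ring.
Qed.

Lemma near_and_ball (P Q : 'rV[R]_N -> Prop) (x : 'rV[R]_N) :
  (\forall y \near x, P y) -> (\forall y \near x, Q y) ->
  \forall y \near x, P y /\ Q y.
Proof.
move=> /nbhs_ballP[d d0 dP] /nbhs_ballP[e e0 eQ]; apply/nbhs_ballP.
exists (Num.min d e); first by rewrite /= lt_min d0 e0.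
move=> y xy; split; [apply: dP|apply: eQ]; apply: le_ball xy.
  by rewrite ge_min lexx.
by rewrite ge_min lexx orbT.
Qed.

(** The second difference is symmetric in i and j, so the two mixed partials take a common value at
    points arbitrarily close to x; continuity concludes. *)
Lemma pd_comm g i j (x : 'rV[R]_N) : smooth_on U g -> U x -> pd i (pd j g) x = pd j (pd i g) x.
Proof.
move=> sg Ux.
suff close e : 0 < e -> `|pd i (pd j g) x - pd j (pd i g) x| <= e.
  apply/eqP; rewrite -subr_eq0 -normr_le0; apply/ler_addgt0Pl => e e0.
  by rewrite addr0 close.
move=> e0.
have e20 : 0 < e / 2 by rewrite divr_gt0.
have [cij _] := sg [:: i; j] x Ux; have [cji _] := sg [:: j; i] x Ux.
have n1 : \forall y \near x, U y by apply: open_nbhs_nbhs; split.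
have n2 : \forall y \near x, `|pd i (pd j g) x - pd i (pd j g) y| <= e / 2.
  by move/cvgrPdist_le : cij; apply.
have n3 : \forall y \near x, `|pd j (pd i g) x - pd j (pd i g) y| <= e / 2.
  by move/cvgrPdist_le : cji; apply.
have /nbhs_ballP[d /= d0 xd] := near_and_ball n1 (near_and_ball n2 n3).
(* A coordinate moves by at most 2 t < d, even when i = j, so all intermediate points stay in the
   ball. *)
pose t := d / 3; have t0 : 0 < t by rewrite divr_gt0.
have inball k l s u : `|s| <= `|t| -> `|u| <= `|t| ->
    ball x d (x + s *: ev R k + u *: ev R l).
  rewrite (gtr0_norm t0) => st ut; split=> // a b.
  rewrite /ball /= !mxE !ord1 /=.
  rewrite -addrA opprD addrA subrr sub0r normrN.
  apply: le_lt_trans (ler_normD _ _) _; rewrite !normrM.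
  have le1 (c : bool) : `|c%:R : R| <= 1 by case: c; rewrite ?normr1 ?normr0.
  apply: (@le_lt_trans _ _ (t + t)); last by rewrite /t; lra.
  by apply: lerD; rewrite -[leRHS]mulr1 ler_pM.
have [s1 [u1 [s1t u1t e1]]] := @second_difference g i j x t sg
  (fun s u st ut => let: conj h _ := xd _ (inball i j s u st ut) in h).
have [s2 [u2 [s2t u2t e2]]] := @second_difference g j i x t sg
  (fun s u st ut => let: conj h _ := xd _ (inball j i s u st ut) in h).
have e12 : pd j (pd i g) (x + s1 *: ev R i + u1 *: ev R j) =
  pd i (pd j g) (x + s2 *: ev R j + u2 *: ev R i).
  have tn : t != 0 by rewrite gt_eqF.
  apply: (mulIf tn); apply: (mulIf tn); apply: (etrans (esym e1)); apply: etrans e2.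
  rewrite (addrAC x (t *: ev R j)).
  move: (g (x + t *: ev R i + t *: ev R j)) (g (x + t *: ev R j)) (g (x + t *: ev R i)) (g x).
  by move=> a1 a2 a3 a4; ring.
have [_ [_ b1]] := xd _ (inball i j _ _ s1t u1t).
have [_ [b2 _]] := xd _ (inball j i _ _ s2t u2t).
rewrite e12 in b1; rewrite [e]splitr.
apply: le_trans (ler_distD _ _ _) _; apply: lerD; first exact: b2.
by rewrite distrC.
Qed.

Lemma first_order g (x : 'rV[R]_N) e : smooth_on U g -> U x -> 0 < e ->
  \forall y \near x, `|g y - g x - \sum_k pd k g x * (y 0 k - x 0 k)|
    <= e * \sum_k `|y 0 k - x 0 k|.
Proof.
move=> sg Ux e0.
have : \forall y \near x, U y /\ forall k, `|pd k g x - pd k g y| <= e.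
  have n1 : \forall y \near x, U y by apply: open_nbhs_nbhs; split.
  have n2 : \forall y \near x, forall k, `|pd k g x - pd k g y| <= e.
    have n2k k : \forall y \near x, `|pd k g x - pd k g y| <= e.
      by have [ck _] := sg [:: k] x Ux; move/cvgrPdist_le : ck; apply.
    suff : \forall y \near x, forall k, k \in enum 'I_N -> `|pd k g x - pd k g y| <= e.
      move=> /nbhs_ballP[d d0 xd]; apply/nbhs_ballP; exists d => // y xy k.
      by apply: (xd y xy); rewrite mem_enum.
    elim: (enum _) => [|k ks IH]; first by apply/nbhs_ballP; exists 1 => //=.
    have /nbhs_ballP[d d0 xd] := near_and_ball (n2k k) IH; apply/nbhs_ballP.
    exists d => // y /xd[yk yks] l; rewrite inE => /orP[/eqP ->//|]; exact: yks.
  exact: near_and_ball n1 n2.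
move=> /nbhs_ballP[d /= d0 xd]; apply/nbhs_ballP; exists d => //= y xy.
(* The path from x to y that replaces one coordinate at a time: its increments telescope, and each
   is parallel to an axis, where the mean value theorem applies. *)
pose w (m : nat) : 'rV[R]_N := \row_k if (k < m)%N then y 0 k else x 0 k.
have w0 : w 0%N = x by apply/rowP => k; rewrite mxE.
have wN : w N = y by apply/rowP => k; rewrite mxE ltn_ord.
have wS (m : 'I_N) : w m.+1 = w m + (y 0 m - x 0 m) *: ev R m.
  apply/rowP => k; rewrite !mxE eqxx ltnS leq_eqVlt /=.
  have [->|km] := eqVneq k m; first by rewrite eqxx ltnn /= mulr1 addrC subrK.
  by rewrite -val_eqE in km; rewrite (negbTE km) mulr0 addr0.
have inball (m : 'I_N) (s : R) : `|s| <= `|y 0 m - x 0 m| -> ball x d (w m + s *: ev R m).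
  move=> sm; split=> // a b; rewrite /ball /= !mxE !ord1 eqxx /=.
  have xyk k : `|x 0 k - y 0 k| < d by have := xy.2 0 k; rewrite /ball /=.
  have [->|km] := eqVneq b m.
    rewrite ltnn mulr1 opprD addrA subrr sub0r normrN (le_lt_trans sm) //.
    by rewrite distrC.
  by rewrite mulr0 addr0; case: ifP => // _; rewrite subrr normr0.
have step (m : 'I_N) : `|g (w m.+1) - g (w m) - pd m g x * (y 0 m - x 0 m)|
    <= e * `|y 0 m - x 0 m|.
  have fd (s : R) : `|s| <= `|y 0 m - x 0 m| ->
     is_derive s 1 (fun s => g (w m + s *: ev R m)) (pd m g (w m + s *: ev R m)).
    by move=> /inball /xd[? _]; exact: ider_line.
  have [c /inball /xd[_ /(_ m) cm]] := mean_value0 fd.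
  rewrite scale0r addr0 -wS => ->; rewrite -mulrBl normrM distrC.
  by rewrite ler_wpM2r.
have -> : g y - g x = \sum_(m < N) (g (w m.+1) - g (w m)).
  by rewrite -wN -w0 -(telescope_sumr (fun m => g (w m)) (leq0n N)) big_mkord.
rewrite -sumrB mulr_sumr; apply: le_trans (ler_norm_sum _ _ _) _.
by apply: ler_sum => m _; exact: step.
Qed.

Lemma ider_near_lipschitz (f : R -> R) (t a : R) : is_derive t 1 f a ->
  \forall s \near t, `|f s - f t| <= (`|a| + 1) * `|s - t|.
Proof.
move=> /is_derive1_caratheodory[q [fq qc qt]].
near=> s; rewrite fq normrM ler_wpM2r // -qt.
rewrite -lerBlDl; apply: le_trans (lerB_dist _ _) _.
rewrite distrC; near: s.
by move/cvgrPdist_le : qc; apply.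
Unshelve. all: by end_near. Qed.

Lemma ider0_littleo (f : R -> R) (t : R) :
  (forall e, 0 < e -> \forall s \near t, `|f s - f t| <= e * `|s - t|) ->
  is_derive t 1 f 0.
Proof.
move=> fo; apply/is_derive1_caratheodory.
pose q s := if s == t then 0 else (f s - f t) / (s - t).
have qt : q t = 0 by rewrite /q eqxx.
exists q; split=> //.
  move=> s; rewrite /q; case: eqVneq => [->|st]; first by rewrite !subrr mulr0.
  by rewrite divfK // subr_eq0.
suff : q s @[s --> t] --> (0 : R) by rewrite -[X in _ --> X]qt.
apply/cvgrPdist_le => e e0; near=> s; rewrite /q.
rewrite sub0r normrN; case: eqVneq => [_|st]; first by rewrite normr0 ltW.
rewrite normrM normfV ler_pdivrMr ?normr_gt0 ?subr_eq0 //.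
by near: s; exact: fo.
Unshelve. all: by end_near. Qed.

(** After subtracting the linear form [L] composed with c, the remainder is o(s - t): [first_order]
    bounds it by a small multiple of the displacement of c, which is Lipschitz at t. *)
Lemma ider_chain g (c : R -> 'rV[R]_N) (t : R) d : smooth_on U g -> U (c t) -> mxder c t d ->
  is_derive t 1 (fun s => g (c s)) (\sum_k pd k g (c t) * d 0 k).
Proof.
move=> sg Ut cd.
have cc : c s @[s --> t] --> c t.
  apply: (@differentiable_continuous _ _ _ t c); apply/derivable1_diffP/derivable_mxP => i j.
  by case: (cd i j).
pose L s := \sum_k pd k g (c t) * c s 0 k.
have dL : is_derive t 1 L (\sum_k pd k g (c t) * d 0 k).
  apply: ider_sum => k; apply: is_derive_eq (ider_mul (ider_cst t _) (cd 0 k)) _.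
  by rewrite mul0r add0r.
suff dr : is_derive t 1 (fun s => g (c s) - L s) 0.
  apply: is_derive_eq (_ : is_derive t 1 (fun s => g (c s)) (0 + \sum_k pd k g (c t) * d 0 k)) _; last by rewrite add0r.
  have := ider_add dr dL; congr (is_derive _ _ _ _).
  by apply/funext => s; rewrite subrK.
apply: ider0_littleo => e e0.
(* A bound for the sum of the Lipschitz constants of the coordinates; the final 1 keeps it positive
   in dimension 0. *)
pose C := \sum_k (`|d 0 k| + 1) + 1.
have C0 : 0 < C.
  by rewrite ltr_wpDl // sumr_ge0 // => k _; rewrite addr_ge0.
have lip : \forall s \near t, forall k, `|c s 0 k - c t 0 k| <= (`|d 0 k| + 1) * `|s - t|.
  exact: (@filter_forall R 'I_N (fun k s => `|c s 0 k - c t 0 k| <= (`|d 0 k| + 1) * `|s - t|)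
    (nbhs t) _ (fun k => ider_near_lipschitz (cd 0 k))).
have := cc _ (first_order sg Ut (divr_gt0 e0 C0)); rewrite /= => fo.
near=> s.
have -> : g (c s) - L s - (g (c t) - L t) =
   g (c s) - g (c t) - \sum_k pd k g (c t) * (c s 0 k - c t 0 k).
  have -> : \sum_k pd k g (c t) * (c s 0 k - c t 0 k) = L s - L t.
    by rewrite -sumrB; apply: eq_bigr => k _; rewrite mulrBr.
  ring.
apply: le_trans (_ : e / C * \sum_k `|c s 0 k - c t 0 k| <= _); first by near: s.
rewrite mulrAC ler_pdivrMr // -mulrA ler_pM2l //.
apply: (@le_trans _ _ (\sum_k (`|d 0 k| + 1) * `|s - t|)).
  apply: ler_sum => k _; move: k; near: s; exact: lip.
by rewrite -mulr_suml mulrC ler_wpM2l // lerDl.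
Unshelve. all: by end_near. Qed.
End MeanValue.

(** * The covariant form of the mean curvature *)

Section LinearMaps.
Variables (R : pzRingType) (V U : lmodType R) (F : V -> U).
Hypothesis F_lin : linear F.

Lemma lin_add x y : F (x + y) = F x + F y.
Proof. by have := F_lin 1 x y; rewrite !scale1r. Qed.

Lemma lin0 : F 0 = 0.
Proof. by apply: (addrI (F 0)); rewrite -lin_add !addr0. Qed.

Lemma lin_sumZ (I : Type) (s : seq I) (a : I -> R) (x : I -> V) :
  F (\sum_(i <- s) a i *: x i) = \sum_(i <- s) a i *: F (x i).
Proof.
by elim/big_rec2: _ => [|i u v _ <-]; [exact: lin0|exact: F_lin].
Qed.
End LinearMaps.

(** The ambient Christoffel terms are absorbed into the second derivatives of f, so the derivative
    of the induced metric involves only the covariant derivative of df. *)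
Lemma gram_variation (R : numFieldType) N n (S z : 'M[R]_(N, n)) (G h : 'M[R]_N) :
  (S^T *m h + z^T *m (G^T *m h + h *m G)) *m z + z^T *m h *m S =
  (S + G *m z)^T *m h *m z + z^T *m h *m (S + G *m z).
Proof.
by rewrite !mxdistr; apply/matrixP => a b; rewrite !mxentry; ring.
Qed.

Lemma cancel_vol (F : fieldType) (r V a b c : F) : V != 0 ->
  (r * V)^-1 * (V * a - V * b - V * c) = r^-1 * (a - b - c).
Proof. by move=> V0; rewrite -!mulrBr invfM -mulrA (mulKf V0). Qed.

(** Bookkeeping for [meancurv_covariant], on abstract groups to keep rewriting away from large
    terms. S is the variation along the ambient derivatives and H along the Hessian of f; A is the
    orbit term, B the covariant derivative of W, C the compensating Christoffel variation of z, T
    the normal and X the tangential part. *)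
Lemma regroup (V : zmodType) (S A B C H T X : V) :
  S = A + B + C -> C + H = T + X -> S + H = A + B + T + X.
Proof. by move=> -> e; rewrite -addrA e addrA. Qed.

Lemma regroup_entry (V : zmodType) m k (S H A B T X : 'M[V]_(m, k)) g i :
  S + H = A + B + T + X -> S g i + H g i = A g i + B g i + T g i + X g i.
Proof. by move=> /matrixP/(_ g i); rewrite !mxE. Qed.

Lemma sum_regroup (V : zmodType) (I : finType) (S H A B T X : I -> V) :
  (forall i, S i + H i = A i + B i + T i + X i) -> \sum_i X i = 0 ->
  \sum_i S i + \sum_i H i = \sum_i A i + \sum_i B i + \sum_i T i.
Proof.
move=> e X0; rewrite -big_split (eq_bigr _ (fun i _ => e i)).
by rewrite !big_split /= X0 addr0.
Qed.

Lemma cancel_christoffel (V : zmodType) (d S H A B T : V) :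
  S + H = A + B + T -> d + A - H - S = d - B - T.
Proof. by move=> e; rewrite -addrA -opprD (addrC H) e !opprD !addrA addrK. Qed.

Section Geometry.
Variables (R : realType) (n p : nat) (v : volume).
Let N := (n + p)%N.
Variables (Ut : set 'rV[R]_N) (U : set 'rV[R]_n).
Variables (ht : 'rV[R]_N -> 'M[R]_N) (Wt : 'rV[R]_N -> 'rV[R]_N) (f : 'rV[R]_n -> 'rV[R]_N).
Hypothesis Ut_open : open Ut.
Hypothesis U_open : open U.
Hypothesis ht_smooth : forall a b, smooth_on Ut (fun y => ht y a b).
Hypothesis ht_sym : forall x, Ut x -> (ht x)^T = ht x.
Hypothesis ht_pos : forall x, Ut x -> posdef (ht x).
Hypothesis Wt_smooth : forall a, smooth_on Ut (fun y => Wt y 0 a).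
Hypothesis Wt_lt1 : forall x, Ut x -> Wnorm2 ht Wt x < 1.
Hypothesis f_U : forall x, U x -> Ut (f x).
Hypothesis f_smooth : forall a, smooth_on U (fun y => f y 0 a).
Hypothesis f_rank : forall x, U x -> \rank (zf f x) = n.

(** Lowering the first index cancels the inverse metric; used for both the ambient and the induced
    connection. *)
Lemma lower_christoffel m (A : 'M[R]_m) (w : 'I_m -> R) c : A \in unitmx ->
  \sum_b A c b * (2^-1 * \sum_l invmx A b l * w l) = 2^-1 * w c.
Proof.
move=> uA; pose wc : 'cV[R]_m := \col_l w l.
transitivity (2^-1 * (A *m (invmx A *m wc)) c 0); last by rewrite mulKVmx // mxE.
rewrite mxE mulr_sumr; apply: eq_bigr => b _; rewrite mulrCA; congr (_ * (_ * _)).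
by rewrite mxE; apply: eq_bigr => l _; rewrite mxE.
Qed.

Section Ambient.
Variable x : 'rV[R]_N.
Hypothesis Ux : Ut x.

Lemma ht_unit : ht x \in unitmx.
Proof. by rewrite unitmxE unitfE gt_eqF // posdef_det //; exact: ht_pos. Qed.

Lemma pd_ht_sym e : (pd_ht ht e x)^T = pd_ht ht e x.
Proof.
apply/matrixP => a b; rewrite !mxE /pd !derive1E; apply: near_eq_derive.
near=> t; have tU : Ut (x + t *: ev R e) by near: t; exact: near_line.
by rewrite -[in RHS](ht_sym tU) mxE.
Unshelve. all: by end_near. Qed.

Definition Gam (e : 'I_N) : 'M[R]_N := \matrix_(a, b) Gammat ht x a e b.

Lemma Gammat_sym a e b : Gammat ht x a e b = Gammat ht x a b e.
Proof.
rewrite /Gammat; congr (_ * _); apply: eq_bigr => l _; congr (_ * _).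
have -> : pd l (fun y => ht y e b) x = pd l (fun y => ht y b e) x.
  by have /matrixP/(_ b e) := pd_ht_sym l; rewrite !mxE.
ring.
Qed.

(** Metric compatibility: when the lowered symbol is added to its transpose, the two other first
    derivatives of the metric cancel. *)
Lemma pd_ht_Gam e : pd_ht ht e x = (Gam e)^T *m ht x + ht x *m Gam e.
Proof.
have low c b : (ht x *m Gam e) c b = 2^-1 * (pd_ht ht e x c b + pd_ht ht b x c e - pd_ht ht c x e b).
  rewrite mxE -[RHS](lower_christoffel (fun c => pd_ht ht e x c b + pd_ht ht b x c e - pd_ht ht c x e b) c ht_unit).
  apply: eq_bigr => a _; rewrite !mxE; congr (_ * (_ * _)).
  by apply: eq_bigr => l _; rewrite !mxE.
have sym l a b : pd_ht ht l x a b = pd_ht ht l x b a by rewrite -[in LHS]pd_ht_sym mxE.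
have -> : (Gam e)^T *m ht x = (ht x *m Gam e)^T by rewrite trmx_mul ht_sym.
apply/matrixP => c b; rewrite addmxE trmx_entry !low.
move: (pd_ht ht) sym => P sym; rewrite (sym e b c) (sym c b e) (sym b c e).
by move: (P e x c b) (P b x e c) (P c x e b) => u1 u2 u3; lra.
Qed.

Definition Wcovmx : 'M[R]_N := \matrix_(b, e) Wcov ht Wt x b e.

Lemma pd_Wt_Gam e : pd_Wt Wt e x = col e Wcovmx - Gam e *m (Wt x)^T.
Proof.
apply/colP => a; rewrite !mxE /Wcov -addrA -[LHS]addr0; congr (_ + _).
apply/esym/eqP; rewrite subr_eq0; apply/eqP/eq_bigr => d _; by rewrite !mxE.
Qed.

(** The partial derivative freezes z, whereas the orbit of [Gam e] moves it by [- (Gam e *m z)]; the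
    last summand restores it. *)
Lemma pd_nav_split (z : 'M[R]_(N, n)) e :
  pd_nav ht Wt e x =
   ((Gam e)^T *m ht x + ht x *m Gam e, - (Gam e *m (Wt x)^T), - (Gam e *m z))
   + (0, col e Wcovmx, 0) + (0, 0, Gam e *m z) :> tangent R N n.
Proof.
rewrite /pd_nav pd_ht_Gam pd_Wt_Gam.
by congr (_, _, _) => /=; rewrite ?addr0 ?addNr // addrC.
Qed.
End Ambient.

Section AtPoint.
Variable x : 'rV[R]_n.
Hypothesis Ux : U x.
Let z := zf f x.
Let h := ht (f x).
Let W := (Wt (f x))^T.
Let fxU : Ut (f x) := f_U Ux.

Definition hess (i : 'I_n) : 'M[R]_(N, n) := \matrix_(a, k) pd i (pd k (fun y => f y 0 a)) x.
Definition Gamt (i : 'I_n) : 'M[R]_N := \sum_e z e i *: Gam (f x) e.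
(** The covariant derivative of df along the i-th coordinate with the ambient connection only;
    [taumx] also subtracts the connection of the induced metric. *)
Definition thess (i : 'I_n) : 'M[R]_(N, n) := hess i + Gamt i *m z.
Definition Gamx (i : 'I_n) : 'M[R]_n := \matrix_(k, j) Gamma ht f x k i j.
Definition taumx (i : 'I_n) : 'M[R]_(N, n) := \matrix_(a, j) tau ht f x a i j.

Lemma zf_regular : regular h W z.
Proof. exact: (nav_regular ht_sym ht_pos Wt_lt1 fxU (f_rank Ux)). Qed.

Lemma hind_unit : gram h z \in unitmx.
Proof. by have [d0 _ _] := zf_regular; rewrite unitmxE unitfE gt_eqF. Qed.

Lemma mxder_f i : mxder (fun t => f (x + t *: ev R i)) 0 (\row_a z a i).
Proof.
move=> o a; rewrite (ord1 o) !mxE; exact: smooth_on_derive (f_smooth a) Ux.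
Qed.

Lemma sum_pd_ht i :
  \sum_e z e i *: pd_ht ht e (f x) = (Gamt i)^T *m h + h *m Gamt i.
Proof.
rewrite /Gamt linear_sum mulmx_suml mulmx_sumr -big_split /=; apply: eq_bigr => e _.
by rewrite (pd_ht_Gam fxU) linearZ /= -scalemxAl -scalemxAr -scalerDr.
Qed.

Lemma mxder_ht_f i :
  mxder (fun t => ht (f (x + t *: ev R i))) 0 ((Gamt i)^T *m h + h *m Gamt i).
Proof.
move=> a b.
have f0 : f (x + (0 : R) *: ev R i) = f x by rewrite scale0r addr0.
have := @ider_chain R N Ut Ut_open (fun y => ht y a b) (fun t => f (x + t *: ev R i)) 0 _
  (ht_smooth a b) _ (mxder_f i).
rewrite f0 => /(_ fxU) d; apply: is_derive_eq d _.
rewrite -sum_pd_ht summxE; apply: eq_bigr => e _; by rewrite !mxE mulrC.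
Qed.

Lemma mxder_zf i : mxder (fun t => zf f (x + t *: ev R i)) 0 (hess i).
Proof.
move=> a k; rewrite mxE; under eq_fun do rewrite mxE.
exact: smooth_on_derive (smooth_on_pd k (f_smooth a)) Ux.
Qed.

Lemma pd_hind i l j : pd i (fun y => hind ht f y l j) x =
  ((thess i)^T *m h *m z + z^T *m h *m thess i) l j.
Proof.
apply: is_derive_derive1.
have := mxderM (mxderM (mxderT (mxder_zf i)) (mxder_ht_f i)) (mxder_zf i).
move=> /(_ l j) d; apply: is_derive_eq d _.
rewrite scale0r addr0 -/z -/h; congr (fun_of_matrix _ l j); exact: gram_variation.
Qed.

Lemma hess_sym i a j : hess i a j = hess j a i.
Proof. by rewrite [LHS]mxE [RHS]mxE; exact: (pd_comm U_open i j (f_smooth a) Ux). Qed.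

Lemma Gamt_z i a j : (Gamt i *m z) a j =
  \sum_(t < N) \sum_(d < N) Gammat ht (f x) a t d * z t j * z d i.
Proof.
rewrite exchange_big /= mulmx_suml summxE; apply: eq_bigr => d _.
rewrite -scalemxAl scalemxE [X in _ * X]mxE mulr_sumr; apply: eq_bigr => t _.
rewrite [Gam _ _ a t]mxE (Gammat_sym fxU a d t).
by move: (Gammat _ _ _ _ _) (z t j) (z d i) => u1 u2 u3; ring.
Qed.

Lemma thessE i a j : thess i a j = hess i a j + (Gamt i *m z) a j.
Proof. exact: addmxE. Qed.

Lemma thess_sym i a j : thess i a j = thess j a i.
Proof.
rewrite (thessE i) (thessE j) (Gamt_z i) (Gamt_z j).
congr (_ + _); first exact: hess_sym.
rewrite exchange_big /=.
apply: eq_bigr => d _; apply: eq_bigr => t _.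
rewrite (Gammat_sym fxU a t d).
by move: (Gammat _ _ _ _ _) (z t j) (z d i) => u1 u2 u3; ring.
Qed.

Lemma taumxE i : taumx i = thess i - z *m Gamx i.
Proof.
apply/matrixP => a j; rewrite addmxE oppmxE thessE (Gamt_z i) [LHS]mxE /tau.
congr (_ + _ - _); first by rewrite [RHS]mxE.
rewrite [RHS]mxE; apply: eq_bigr => k _; by rewrite [Gamx _ _ _]mxE mulrC.
Qed.

(** The induced Christoffel symbols are the tangential part of [thess]. By [pd_hind] each derivative
    in the Koszul combination is a sum of two products of [thess] with z; by [thess_sym] four of the
    six cancel. *)
Lemma gram_Gamx i : gram h z *m Gamx i = z^T *m h *m thess i.
Proof.
apply/matrixP => l j; rewrite mxE.
pose w c := pd i (fun y => hind ht f y c j) x + pd j (fun y => hind ht f y c i) x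
     - pd c (fun y => hind ht f y i j) x.
transitivity (2^-1 * w l).
  rewrite -(lower_christoffel w l hind_unit); apply: eq_bigr => k _.
  congr (_ * _); exact: mxE.
have qE i0 a b : ((thess i0)^T *m h *m z) a b = (z^T *m h *m thess i0) b a.
  have -> : (thess i0)^T *m h *m z = (z^T *m h *m thess i0)^T.
    move: (thess i0) => S; rewrite (trmx_mul _ S) (trmx_mul _ h) trmxK.
    by rewrite /h (ht_sym fxU) mulmxA.
  by rewrite trmx_entry.
have qS i0 a b : (z^T *m h *m thess i0) a b = (z^T *m h *m thess b) a i0.
  by rewrite mxE [RHS]mxE; apply: eq_bigr => c _; rewrite thess_sym.
rewrite /w !pd_hind !addmxE !qE.
rewrite (qS j l i) (qS j i l) (qS i j l).
move: ((z^T *m h *m thess l) j i) ((z^T *m h *m thess l) i j) ((z^T *m h *m thess i) l j).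
by move=> u1 u2 u3; lra.
Qed.

Lemma taumx_normal i : z^T *m h *m taumx i = 0.
Proof. by rewrite taumxE mulmxBr mulmxA -/(gram h z) gram_Gamx subrr. Qed.

Lemma Gamx_sym k i j : Gamx i k j = Gamx j k i.
Proof.
have e i0 : Gamx i0 = cogram h z *m (z^T *m h *m thess i0).
  by rewrite -gram_Gamx mulmxA (mulVgram hind_unit) mul1mx.
rewrite !e mxE [RHS]mxE; apply: eq_bigr => l _; congr (_ * _).
by rewrite mxE [RHS]mxE; apply: eq_bigr => c _; rewrite thess_sym.
Qed.

Lemma tau_sym a i j : tau ht f x a i j = tau ht f x a j i.
Proof.
have e i0 j0 : tau ht f x a i0 j0 = thess i0 a j0 - \sum_k z a k * Gamx i0 k j0.
  by have /matrixP/(_ a j0) := taumxE i0; rewrite mxE => ->; rewrite addmxE oppmxE; congr (_ - _); rewrite mxE.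
rewrite !e thess_sym; congr (_ - _); apply: eq_bigr => k _; by rewrite Gamx_sym.
Qed.

Let r := rho v n (sgoth h W z).
Let r1 := rho' v n (sgoth h W z).
Let r2 := rho'' v n (sgoth h W z).
Let lc := logchi' v n (wnorm h W).
Let D := dlagr h W z r r1 lc.
Let L := dmomentum h W z r r1 r2 lc.
Let M := momentum h W z r r1.
Let Wc := Wcovmx (f x).
Let hT : h^T = h := ht_sym fxU.

Lemma vol_neq0 : vol v h W z != 0.
Proof.
have [d0 _ w1] := zf_regular.
by rewrite mulf_neq0 // ?invr_eq0 gt_eqF // ?sqrtr_gt0 ?chi_gt0.
Qed.

(** F is rho times the volume factor, and that factor also multiplies every derivative, so the
    prefactor 1 / F leaves [r^-1]. *)
Lemma meancurv_variation g : meancurv ht Wt f v x g =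
  r^-1 * (D (pd_nav ht Wt g (f x)) - \sum_i L (0, 0, hess i) g i
     - \sum_i L (\sum_e z e i *: pd_nav ht Wt e (f x)) g i).
Proof.
have reg := zf_regular.
rewrite /meancurv (Fvol_lagr v Wt ht_sym z fxU) -/h -/W -/z.
rewrite (dxt_Fvol v Ut_open ht_smooth ht_sym Wt_smooth fxU reg) -/h -/W -/z -/r -/r1 -/lc -/D.
have -> : \sum_i \sum_e \sum_j dz g i (dz e j (Fvol v ht Wt)) (f x) z * pd i (pd j (fun y => f y 0 e)) x
   = vol v h W z * \sum_i L (0, 0, hess i) g i.
  rewrite mulr_sumr; apply: eq_bigr => i _.
  rewrite -(mxtrace_delta (L (0, 0, hess i))) (dmomentum_sym _ _ _ _ _ _ hT).
  rewrite mxtrace_trmul mulr_sumr; apply: eq_bigr => e _.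
  rewrite mulr_sumr; apply: eq_bigr => j _.
  by rewrite (dzdz_Fvol v ht_sym fxU reg) [hess i e j]mxE mulrA.
have -> : \sum_e \sum_i dxt e (dz g i (Fvol v ht Wt)) (f x) z * pd i (fun y => f y 0 e) x
   = vol v h W z * \sum_i L (\sum_e z e i *: pd_nav ht Wt e (f x)) g i.
  rewrite exchange_big mulr_sumr; apply: eq_bigr => i _ /=.
  rewrite /L (lin_sumZ (@dmomentum_linear R N n h W z r r1 r2 lc)) summxE mulr_sumr.
  apply: eq_bigr => e _; rewrite (dxtdz_Fvol v Ut_open ht_smooth ht_sym Wt_smooth fxU reg).
  rewrite scalemxE [z e i]mxE -mulrA; congr (_ * _); exact: mulrC.
exact: cancel_vol vol_neq0.
Qed.

Lemma sum_pd_nav i : \sum_e z e i *: pd_nav ht Wt e (f x) =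
   ((Gamt i)^T *m h + h *m Gamt i, - (Gamt i *m W), - (Gamt i *m z))
   + (0, Wc *m col i z, 0) + (0, 0, Gamt i *m z) :> tangent R N n.
Proof.
have e1 : \sum_e z e i *: pd_nav ht Wt e (f x) = (\sum_e z e i *: pd_ht ht e (f x),
    \sum_e z e i *: pd_Wt Wt e (f x), 0) :> tangent R N n.
  elim/big_rec3: _ => // e a b c _ ->.
  by rewrite /pd_nav; congr (_, _, _) => /=; rewrite scaler0 addr0.
have e2 : \sum_e z e i *: pd_Wt Wt e (f x) = Wc *m col i z - Gamt i *m W.
  rewrite /Gamt mulmx_suml -[Wc in RHS]mulmx1.
  have -> : Wc *m 1%:M *m col i z = \sum_e z e i *: col e Wc.
    rewrite mulmx1; apply/colP => a; rewrite mxE summxE; apply: eq_bigr => e _.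
    by rewrite scalemxE [col i z e 0]mxE [col e Wc a 0]mxE mulrC.
  rewrite -sumrB; apply: eq_bigr => e _.
  by rewrite pd_Wt_Gam scalerBr -scalemxAl.
rewrite e1 e2 sum_pd_ht.
by congr (_, _, _) => /=; rewrite ?addr0 ?addNr // addrC.
Qed.

(** Torsion-freeness: the Christoffel correction in the derivative of F along g equals the sum of
    the orbit terms [(Gamt i)^T *m M], and the two cancel in the mean curvature. *)
Lemma momentum_Gam g : \tr (M^T *m (Gam (f x) g *m z)) = \sum_i ((Gamt i)^T *m M) g i.
Proof.
rewrite mxtrace_trmul exchange_big /=; apply: eq_bigr => i _; rewrite [RHS]mxE.
apply: eq_bigr => e _; rewrite mulrC; congr (_ * _).
rewrite trmx_entry /Gamt summxE mxE; apply: eq_bigr => d _.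
rewrite scalemxE mulrC; congr (_ * _); rewrite [LHS]mxE [RHS]mxE; exact: Gammat_sym.
Qed.

(** By symmetry of the lower indices both terms are the contraction Gamma^k_{ki} M_{gi}. *)
Lemma Gamx_cancel g : \sum_i (\tr (Gamx i) *: M - M *m (Gamx i)^T) g i = 0.
Proof.
under eq_bigr => i _ do rewrite addmxE oppmxE scalemxE.
rewrite big_split /= sumrN; apply/eqP; rewrite subr_eq0; apply/eqP.
under [RHS]eq_bigr => i _ do rewrite mxE.
rewrite [RHS]exchange_big /=; apply: eq_bigr => i _; rewrite mulr_suml.
apply: eq_bigr => k _; rewrite mulrC trmx_entry; congr (_ * _); exact: Gamx_sym.
Qed.

Lemma meancurv_covariant g : meancurv ht Wt f v x g =
  r^-1 * (D (0, col g Wc, 0) - \sum_i L (0, Wc *m col i z, 0) g i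
          - \sum_i L (0, 0, taumx i) g i).
Proof.
suff key : D (pd_nav ht Wt g (f x)) - \sum_i L (0, 0, hess i) g i
     - \sum_i L (\sum_e z e i *: pd_nav ht Wt e (f x)) g i =
     D (0, col g Wc, 0) - \sum_i L (0, Wc *m col i z, 0) g i
          - \sum_i L (0, 0, taumx i) g i.
  exact: (etrans (meancurv_variation g) (congr1 (fun u => r^-1 * u) key)).
have Dl := @dlagr_linear R N n h W z r r1 lc.
have Ll := @dmomentum_linear R N n h W z r r1 r2 lc.
rewrite (pd_nav_split fxU z) /D (lin_add Dl) (lin_add Dl).
rewrite dlagr_equiv add0r (dlagr_z _ _ _ _ _ hT) -/M momentum_Gam -/D.
(* The compensating [Gamt i *m z] joins [hess i] to form [thess i], which splits as
   [taumx i + z *m Gamx i]. *)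
have e i : L (\sum_e z e i *: pd_nav ht Wt e (f x)) + L (0, 0, hess i) =
    (Gamt i)^T *m M + L (0, Wc *m col i z, 0) + L (0, 0, taumx i)
    + (\tr (Gamx i) *: M - M *m (Gamx i)^T).
  apply: (@regroup _ _ _ _ (L (0, 0, Gamt i *m z))).
    by rewrite sum_pd_nav /L (lin_add Ll) (lin_add Ll) dmomentum_equiv.
  rewrite -(dmomentum_tangent W r r1 r2 lc hT hind_unit) -/L.
  apply: (etrans (esym (lin_add Ll _ _)) (etrans (congr1 L _) (lin_add Ll _ _))).
  congr (_, _, _) => /=; rewrite ?addr0 // taumxE subrK.
  exact: addrC.
apply: cancel_christoffel.
exact: sum_regroup (fun i => regroup_entry g i (e i)) (Gamx_cancel g).
Qed.
End AtPoint.
End Geometry.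

(** * Contractions *)

Section Contractions.
Variables (R : numFieldType) (N n : nat).
Variables (h : 'M[R]_N) (W : 'cV[R]_N) (z : 'M[R]_(N, n)).
Variables (r r1 r2 lc : R).
Hypothesis hT : h^T = h.

Let K := cogram h z.
Let B := z *m K *m z^T.
Let wu := wup h W z.
Let y := wperp h W z.
Let T := z *m wu^T.
Let KT : K^T = K := cogram_sym z hT.

Lemma outer_sum m k (A : 'M[R]_(m, n)) (C : 'M[R]_(n, k)) i j :
  \sum_l A i l * C l j = (A *m C) i j.
Proof. by rewrite mxE. Qed.

Lemma mulmx_col m k (A : 'M[R]_(m, N)) (C : 'M[R]_(N, k)) i j :
  (A *m col j C) i 0 = (A *m C) i j.
Proof. by rewrite !mxE; apply: eq_bigr => l _; rewrite mxE. Qed.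

Lemma mul_cV_rV m k (A : 'cV[R]_m) (C : 'rV[R]_k) i j : (A *m C) i j = A i 0 * C 0 j.
Proof. by rewrite mxE big_ord1. Qed.

Section Killing.
Variables (V S : 'M[R]_N) (g : 'I_N).
Hypothesis SE : h *m V = S.
Hypothesis S_antisym : S^T = - S.
Let WS := W^T *m S.
Let nu := (h *m y) g 0.

(** [A *m C *m A^T] is symmetric, so its trace against S is its own opposite. It is applied to T
    with the identity and to z with K. *)
Lemma antisym_quad m (A : 'M[R]_(N, m)) (C : 'M[R]_m) : C^T = C ->
  \tr (A^T *m S *m A *m C) = 0.
Proof.
move=> CT; have : \tr (A^T *m S *m A *m C) = - \tr (A^T *m S *m A *m C).
  rewrite -[LHS]mxtrace_tr !trmx_mul trmxK CT S_antisym mulNmx !mulmxN mxtraceN.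
  by rewrite mxtrace_mulC !mulmxA.
by move/eqP; rewrite -subr_eq0 opprK -mulr2n mulrn_eq0 /= => /eqP.
Qed.

Lemma mul_wperp_S : y^T *m S = WS - T^T *m S.
Proof. by rewrite /y /wperp -/T trmxD trmxN mulmxDl mulNmx. Qed.

(** Here T is the tangential part of W and nu the g-component of the lowered normal part, that is
    W_t (delta^t_g - B^t_g). *)
Lemma contract_w :
  dlagr h W z r r1 lc (0, col g V, 0)
    - \sum_i dmomentum h W z r r1 r2 lc (0, V *m col i z, 0) g i =
  2 * lc * (2 * r1 * nu * (WS *m T) 0 0 - r * (WS *m (1%:M - B *m h)) 0 g)
  + 2 * (2 * r2 * nu * (WS *m T) 0 0 - r1 * (WS *m (1%:M - B *m h)) 0 g)
  - 4 * r1 * ((1%:M - h *m B) *m S *m T) g 0.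
Proof.
have dl : dlagr h W z r r1 lc (0, col g V, 0) =
    - 2 * r1 * (y^T *m S) 0 g - 2 * r * lc * WS 0 g.
  by rewrite dlagr_w // !trace_mx11 !mulmx_col -!mulmxA SE.
have dm i : dmomentum h W z r r1 r2 lc (0, V *m col i z, 0) g i =
    - 2 * lc * ((WS *m z) 0 i * (momentum h W z r r1) g i)
    - 4 * r2 * nu * ((y^T *m S *m z) 0 i * wu 0 i)
    + 2 * r1 * ((S *m z) g i * wu 0 i - (h *m B *m S *m z) g i * wu 0 i
                + nu * (z^T *m S^T *m z *m K) i i)
    - 2 * r1 * ((y^T *m S *m z) 0 i * (h *m z *m K) g i).
  rewrite dmomentum_w // !trace_mx11 !mxentry.
  rewrite (mulmxA _ V) (mulmxA _ V) !mulmx_col.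
  have e1 : (h *m (V *m col i z) *m wup h W z) g i = (S *m z) g i * wu 0 i.
    by rewrite mul_cV_rV mulmxA SE mulmx_col.
  have e2 : (h *m z *m cogram h z *m z^T *m h *m (V *m col i z) *m wup h W z) g i
     = (h *m B *m S *m z) g i * wu 0 i.
    by rewrite mul_cV_rV (mulmxA _ V) mulmx_col /B -SE -/K !mulmxA.
  have e3 : (h *m wperp h W z *m (V *m col i z)^T *m h *m z *m cogram h z) g i
     = nu * (z^T *m S^T *m z *m K) i i.
    rewrite -!(mulmxA (h *m wperp h W z)) mul_cV_rV; congr (_ * _).
    have -> : (V *m col i z)^T *m h *m z *m cogram h z = row i (z^T *m S^T *m z *m K).
      by rewrite !row_mul -tr_col trmx_mul -SE trmx_mul hT !mulmxA.
    by rewrite mxE.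
  rewrite e1 e2 e3 mul_cV_rV -/wu -/y -/nu -/K.
  rewrite -(mulmxA W^T h V) -(mulmxA _ h V) SE -/WS.
  move: ((WS *m z) 0 i) (momentum h W z r r1 g i) ((y^T *m S *m z) 0 i) (wu 0 i).
  move: ((S *m z) g i) ((h *m B *m S *m z) g i) ((z^T *m S^T *m z *m K) i i) ((h *m z *m K) g i).
  by move=> a1 a2 a3 a4 a5 a6 a7 a8; ring.
have s1 : \sum_i (WS *m z) 0 i * (momentum h W z r r1) g i =
    2 * r1 * nu * (WS *m T) 0 0 + r * (WS *m B *m h) 0 g.
  have -> : \sum_i (WS *m z) 0 i * (momentum h W z r r1) g i =
      ((WS *m z) *m (momentum h W z r r1)^T) 0 g.
    by rewrite -outer_sum; apply: eq_bigr => i _; rewrite trmx_entry.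
  have -> : (WS *m z) *m (momentum h W z r r1)^T =
     (2 * r1) *: ((WS *m T) *m (h *m y)^T) + r *: (WS *m B *m h).
    rewrite /momentum -/wu -/y -/K trmxD !trmxZ mulmxDr -!scalemxAr.
    rewrite (trmx_mul (h *m y) wu) (trmx_mul (h *m z) K) (trmx_mul h z) hT KT.
    by rewrite /T /B !mulmxA.
  rewrite !mxentry (mxE _ _ 0 g) big_ord1 trmx_entry -/nu; ring.
(* Replacing W by its normal part changes nothing here, the difference being the quadratic form of S
   at T. *)
have s2 : \sum_i (y^T *m S *m z) 0 i * wu 0 i = (WS *m T) 0 0.
  have -> : \sum_i (y^T *m S *m z) 0 i * wu 0 i = (y^T *m S *m T) 0 0.
    rewrite /T mulmxA -outer_sum; apply: eq_bigr => i _; by rewrite trmx_entry.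
  rewrite mul_wperp_S mulmxBl addmxE oppmxE.
  have := @antisym_quad 1 T 1%:M (trmx1 _ _); rewrite mulmx1 trace_mx11 => ->.
  by rewrite subr0.
have s3 m (A : 'M[R]_(m, N)) i0 : \sum_i (A *m z) i0 i * wu 0 i = (A *m T) i0 0.
  rewrite /T mulmxA -outer_sum; apply: eq_bigr => i _; by rewrite trmx_entry.
have s4 : \sum_i (z^T *m S^T *m z *m K) i i = 0.
  have := @antisym_quad n z K KT; rewrite /mxtrace S_antisym mulmxN !mulNmx => e.
  by apply/eqP; rewrite -oppr_eq0 -sumrN; apply/eqP; rewrite -[RHS]e; apply: eq_bigr => i _; rewrite oppmxE opprK.
have s5 : \sum_i (y^T *m S *m z) 0 i * (h *m z *m K) g i = (y^T *m S *m B *m h) 0 g.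
  have -> : y^T *m S *m B *m h = (y^T *m S *m z) *m (h *m z *m K)^T.
    by rewrite (trmx_mul (h *m z) K) (trmx_mul h z) hT KT /B !mulmxA.
  by rewrite -outer_sum; apply: eq_bigr => i _; rewrite trmx_entry.
under eq_bigr => i _ do rewrite dm.
rewrite !big_split /= !sumrN -!mulr_sumr big_split /= big_split /= sumrN -mulr_sumr.
rewrite s1 s2 s3 s3 s4 s5 dl.
(* Splitting [y^T *m S] leaves a term in T which, by antisymmetry, is the transpose of the one
   produced by the variation of the momentum; together they make the coefficient 4. *)
have eP : (1%:M - h *m B) *m S *m T = - (T^T *m S *m (1%:M - B *m h))^T.
  have BT : B^T = B by rewrite /B !trmx_mul trmxK KT mulmxA.
  rewrite (trmx_mul (T^T *m S)) (trmx_mul T^T S) trmxK S_antisym.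
  by rewrite trmxD trmxN trmx1 (trmx_mul B h) hT BT mulNmx mulmxN opprK mulmxA.
have eQ : ((1%:M - h *m B) *m S *m T) g 0 = - (T^T *m S *m (1%:M - B *m h)) 0 g.
  by rewrite eP oppmxE trmx_entry.
have eQ' : ((1%:M - h *m B) *m S *m T) g 0 = (S *m T) g 0 - (h *m B *m S *m T) g 0.
  by rewrite mulmxBl mulmxBl mul1mx addmxE oppmxE.
have split1 (X : 'rV[R]_N) : (X *m (1%:M - B *m h)) 0 g = X 0 g - (X *m B *m h) 0 g.
  by rewrite mulmxBr mulmx1 (mulmxA X) addmxE oppmxE.
have ey0 : (y^T *m S) 0 g = WS 0 g - (T^T *m S) 0 g by rewrite mul_wperp_S addmxE oppmxE.
have ey1 : (y^T *m S *m B *m h) 0 g = (WS *m B *m h) 0 g - (T^T *m S *m B *m h) 0 g.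
  by rewrite mul_wperp_S !mulmxBl addmxE oppmxE.
move: eQ eQ'; rewrite !split1 ey0 ey1.
move: (((1%:M - h *m B) *m S *m T) g 0) => q.
move: ((T^T *m S) 0 g) ((T^T *m S *m B *m h) 0 g) ((S *m T) g 0) => u1 u2 u3.
move: ((h *m B *m S *m T) g 0) ((WS *m T) 0 0) (WS 0 g) ((WS *m B *m h) 0 g) => u4 u5 u6 u7.
move=> -> e; have -> : u3 = - (u1 - u2) + u4 by rewrite e subrK.
ring.
Qed.
End Killing.

Section Normal.
Variables (tau : 'I_N -> 'I_n -> 'I_n -> R) (Tau : 'I_n -> 'M[R]_(N, n)) (g : 'I_N).
Hypothesis TauE : forall i a j, Tau i a j = tau a i j.
Hypothesis tau_sym : forall a i j, tau a i j = tau a j i.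
Hypothesis Tau_normal : forall i, z^T *m h *m Tau i = 0.
Let nu := (h *m y) g 0.
Let wl a := (h *m W) a 0.

Lemma contract_normal :
  \sum_i dmomentum h W z r r1 r2 lc (0, 0, Tau i) g i =
  \sum_a \sum_i \sum_j (K i j * (2 * r1 * (wl a * nu) + r * h g a)
     + 2 * (wu 0 i * wu 0 j) * (2 * r2 * (wl a * nu) - r1 * h g a)) * tau a i j.
Proof.
pose phi i j := \sum_a wl a * tau a i j.
have phiE i j : (W^T *m h *m Tau i) 0 j = phi i j.
  rewrite mxE; apply: eq_bigr => a _; rewrite TauE; congr (_ * _).
  by rewrite /wl -[h in RHS]hT -[W in RHS]trmxK -trmx_mul trmx_entry.
pose hz j := (h *m z *m K) g j.
pose ht i j := \sum_a h g a * tau a i j.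
have htE i j : (h *m Tau i) g j = ht i j.
  by rewrite mxE; apply: eq_bigr => a _; rewrite TauE.
have phi_sym i j : phi i j = phi j i by apply: eq_bigr => a _; rewrite tau_sym.
have tr i : \tr (W^T *m h *m Tau i *m wu^T) = \sum_j phi i j * wu 0 j.
  rewrite trace_mx11 -outer_sum; apply: eq_bigr => j _.
  by rewrite phiE trmx_entry.
have dm i : dmomentum h W z r r1 r2 lc (0, 0, Tau i) g i =
   \sum_j (4 * r2 * nu * (phi i j * wu 0 j * wu 0 i)
    + 2 * r1 * nu * (phi i j * K j i) - 2 * r1 * (ht i j * wu 0 j * wu 0 i)
    + r * (ht i j * K j i)
    + 2 * r1 * (phi i j * wu 0 j * hz i - hz j * phi i j * wu 0 i)).
  rewrite dmomentum_normal //; rewrite -/wu -/K -/y !mxentry tr.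
  have e1 : (h *m y *m W^T *m h *m Tau i *m K) g i = \sum_j nu * (phi i j * K j i).
    rewrite -mulr_sumr -!(mulmxA (h *m y)) mul_cV_rV; congr (_ * _); rewrite mxE.
    by apply: eq_bigr => j _; rewrite phiE.
  have e2 : (h *m Tau i *m wu^T *m wu) g i = \sum_j ht i j * wu 0 j * wu 0 i.
    rewrite mul_cV_rV [X in X * _]mxE mulr_suml; apply: eq_bigr => j _.
    by rewrite htE trmx_entry.
  have e3 : (h *m z *m K *m (Tau i)^T *m h *m W *m wu) g i = \sum_j hz j * phi i j * wu 0 i.
    rewrite mul_cV_rV -!(mulmxA (h *m z *m K)) [X in X * _]mxE mulr_suml; apply: eq_bigr => j _.
    congr (_ * _ * _); rewrite -phiE -[in RHS](trmx_entry _ j 0).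
    by congr (fun_of_matrix _ j 0); rewrite (trmx_mul (W^T *m h)) (trmx_mul W^T) hT trmxK mulmxA.
  have e4 : (h *m Tau i *m K) g i = \sum_j ht i j * K j i.
    by rewrite mxE; apply: eq_bigr => j _; rewrite htE.
  have e5 : (h *m y *m wu) g i = nu * wu 0 i by rewrite mul_cV_rV.
  rewrite e1 e2 e3 e4 e5 -/(hz i).
  rewrite !mulr_sumr !mulr_suml -!sumrB !mulr_sumr -!big_split /=.
  apply: eq_bigr => j _.
  move: (phi i j) (wu 0 j) (wu 0 i) (K j i) (ht i j) (hz i) (hz j) nu => a1 a2 a3 a4 a5 a6 a7 a8.
  by ring.
under eq_bigr => i _ do rewrite dm big_split /=.
(* The terms containing [hz] are exchanged with opposite signs under i, j because [phi] is
   symmetric, so they vanish in the double sum. *)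
rewrite big_split /= [X in _ + X](_ : _ = 0) ?addr0; last first.
  under eq_bigr => i _ do rewrite -mulr_sumr sumrB.
  rewrite -mulr_sumr sumrB; apply/eqP; rewrite mulf_eq0 subr_eq0; apply/orP; right; apply/eqP.
  rewrite [RHS]exchange_big /=; apply: eq_bigr => i _; apply: eq_bigr => j _.
  by rewrite (phi_sym j i) mulrC mulrA.
rewrite [RHS]exchange_big /=; apply: eq_bigr => i _.
rewrite [RHS]exchange_big /=; apply: eq_bigr => j _.
have KS : K j i = K i j by rewrite -[in LHS]KT trmx_entry.
rewrite KS /phi /ht !(mulr_suml, mulr_sumr) -big_split -sumrB -big_split /=; apply: eq_bigr => a _.
move: (wl a) (tau a i j) (wu 0 j) (wu 0 i) (K i j) (h g a) nu => a1 a2 a3 a4 a5 a6 a7.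
by ring.
Qed.
End Normal.
End Contractions.

(** The q are the matrix forms of the contractions and the s their index forms; with both abstract,
    [ring] handles scalars only. *)
Lemma meancurv_assembly (F : fieldType) (m r d a b lc r1 q1 q2 q3 q4 s1 s2 s3 s4 : F) :
  m = r^-1 * (d - a - b) -> d - a = 2 * lc * q1 + 2 * q2 - 4 * r1 * q3 -> b = q4 ->
  s1 = q1 -> s2 = q3 -> s3 = q2 -> s4 = q4 ->
  m = 2 * lc / r * s1 - r^-1 * (4 * r1 * s2 - 2 * s3) - r^-1 * s4.
Proof. by move=> -> -> -> -> -> -> ->; ring. Qed.

(** * Translation of the matrix contractions into index notation *)

Section IndexNotation.
Variables (R : realType) (n p : nat).
Let N := (n + p)%N.
Variables (ht : 'rV[R]_N -> 'M[R]_N) (Wt : 'rV[R]_N -> 'rV[R]_N) (f : 'rV[R]_n -> 'rV[R]_N).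
Variables (x : 'rV[R]_n) (g : 'I_N).
Let z := zf f x.
Let h := ht (f x).
Let W := (Wt (f x))^T.
Hypothesis hT : h^T = h.
Let K := cogram h z.
Let B := z *m K *m z^T.
Let wu := wup h W z.
Let T := z *m wu^T.
Let Wl a := (h *m W) a 0.
Let P : 'M[R]_N := 1%:M - B *m h.

Lemma BupE a b : Bup ht f x a b = B a b.
Proof.
rewrite [RHS]mxE /Bup exchange_big /=; apply: eq_bigr => j _.
rewrite [(z *m K) a j]mxE mulr_suml; apply: eq_bigr => i _.
by rewrite trmx_entry; congr (_ * _); exact: mulrC.
Qed.

Lemma projE a b : kron a b - Bmix ht f x a b = P a b.
Proof.
rewrite /P addmxE oppmxE [1%:M a b]mxE; congr (_ - _); rewrite [RHS]mxE.
by apply: eq_bigr => d _; rewrite BupE.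
Qed.

Lemma WlE a : Wlow ht Wt (f x) a = Wl a.
Proof. exact: WlowE. Qed.

Lemma wupE i : \sum_a Wl a * Aup ht f x i a = wu 0 i.
Proof.
have e : wu^T = (K *m z^T) *m (h *m W).
  by rewrite /wu wup_tr // !mulmxA.
rewrite -(trmx_entry wu) e mxE; apply: eq_bigr => a _; rewrite mulrC; congr (_ * _).
by rewrite mxE; apply: eq_bigr => j _; rewrite trmx_entry.
Qed.

Lemma wlow_rowE i : wlow h W z 0 i = \sum_a Wlow ht Wt (f x) a * z a i.
Proof.
rewrite /wlow mxE; apply: eq_bigr => a _; rewrite WlE /Wl; congr (_ * _).
by rewrite -(trmx_entry (h *m W)) trmx_mul hT.
Qed.

Lemma sfrakE : sfrak ht Wt f x = sgoth h W z.
Proof.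
rewrite /sfrak /sgoth Wnorm2E; congr (_ + _).
rewrite trace_mx11 mxE exchange_big /=; apply: eq_bigr => j _.
rewrite mxE mulr_suml; apply: eq_bigr => i _.
rewrite trmx_entry !wlow_rowE -/K; congr (_ * _); exact: mulrC.
Qed.

(** P is the h-self-adjoint projection on the normal space, so applying [P^T] to the lowered W
    lowers its normal part. *)
Lemma nuE : \sum_b Wl b * P b g = (h *m wperp h W z) g 0.
Proof.
have e : h *m wperp h W z = P^T *m (h *m W).
  rewrite /wperp wup_tr // /P /B trmxD trmxN trmx1 !trmx_mul trmxK hT cogram_sym //.
  by rewrite mulmxBr mulmxBl mul1mx !mulmxA.
by rewrite e mxE; apply: eq_bigr => b _; rewrite trmx_entry mulrC.
Qed.
Let nu := (h *m wperp h W z) g 0.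

Lemma tangentE e : \sum_d B e d * Wl d = T e 0.
Proof.
have -> : T = B *m (h *m W) by rewrite /T /B /wu wup_tr // !mulmxA.
by rewrite mxE.
Qed.

Let S := h *m Wcovmx ht Wt (f x).

Lemma WcovlowE a e : Wcovlow ht Wt (f x) a e = S a e.
Proof. by rewrite mxE; apply: eq_bigr => b _; rewrite [Wcovmx _ _ _ b e]mxE. Qed.

(** The same term as the bracket of the theorem, so that [sum_bra] closes two of its goals by
    conversion: with coefficients (rho', rho) and with (rho'', rho'). *)
Let bra (a1 a0 : R) (e : 'I_N) :=
  2 * a1 * (\sum_d \sum_t Bup ht f x e d * Wlow ht Wt (f x) d * Wlow ht Wt (f x) t *
     (kron t g - Bmix ht f x t g)) - a0 * (kron e g - Bmix ht f x e g).

Lemma braE a1 a0 e : bra a1 a0 e = 2 * a1 * (T e 0 * nu) - a0 * P e g.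
Proof.
rewrite /bra projE; congr (_ * _ - _).
rewrite -tangentE /nu -nuE mulr_suml; apply: eq_bigr => d _.
rewrite mulr_sumr; apply: eq_bigr => t _.
by rewrite BupE !WlE projE !mulrA.
Qed.

Lemma sum_bra a1 a0 :
  \sum_e bra a1 a0 e * (\sum_a Wcovlow ht Wt (f x) a e * Wt (f x) 0 a) =
  2 * a1 * nu * (W^T *m S *m T) 0 0 - a0 * (W^T *m S *m P) 0 g.
Proof.
rewrite !mxE !mulr_sumr -sumrB; apply: eq_bigr => e _; rewrite braE.
have -> : \sum_a Wcovlow ht Wt (f x) a e * Wt (f x) 0 a = (W^T *m S) 0 e.
  by rewrite mxE; apply: eq_bigr => a _; rewrite WcovlowE trmxK mulrC.
move: ((W^T *m S) 0 e) (T e 0) (P e g) nu => u1 u2 u3 u4; ring.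
Qed.

Lemma sum_curl :
  \sum_e \sum_b \sum_a Bup ht f x e b * Wcovlow ht Wt (f x) a e * Wlow ht Wt (f x) b *
     (kron a g - Bmix ht f x a g) = ((1%:M - h *m B) *m S *m T) g 0.
Proof.
have PT : P^T = 1%:M - h *m B.
  by rewrite /P /B trmxD trmxN trmx1 !trmx_mul trmxK hT cogram_sym // !mulmxA.
rewrite -PT mxE; apply: eq_bigr => e _.
rewrite -tangentE mulr_sumr; apply: eq_bigr => b _.
rewrite mxE mulr_suml; apply: eq_bigr => a _.
rewrite BupE WcovlowE WlE projE trmx_entry.
move: (B e b) (S a e) (Wl b) (P a g) => u1 u2 u3 u4; ring.
Qed.

Lemma sum_tau (r0 r1 r2 : R) :
  \sum_a \sum_i \sum_j
      (hinv ht f x i j * (2 * r1 * (\sum_b Wlow ht Wt (f x) a * Wlow ht Wt (f x) b *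
           (kron b g - Bmix ht f x b g)) + r0 * ht (f x) g a)
       + 2 * (\sum_d \sum_t Wlow ht Wt (f x) d * Wlow ht Wt (f x) t *
            Aup ht f x i d * Aup ht f x j t)
           * (2 * r2 * (\sum_b Wlow ht Wt (f x) a * Wlow ht Wt (f x) b *
              (kron b g - Bmix ht f x b g)) - r1 * ht (f x) g a))
      * tau ht f x a i j =
  \sum_a \sum_i \sum_j (K i j * (2 * r1 * (Wl a * nu) + r0 * h g a)
     + 2 * (wu 0 i * wu 0 j) * (2 * r2 * (Wl a * nu) - r1 * h g a)) * tau ht f x a i j.
Proof.
apply: eq_bigr => a _; apply: eq_bigr => i _; apply: eq_bigr => j _.
have -> : \sum_b Wlow ht Wt (f x) a * Wlow ht Wt (f x) b * (kron b g - Bmix ht f x b g) = Wl a * nu.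
  rewrite /nu -nuE mulr_sumr; apply: eq_bigr => b _.
  by rewrite !WlE projE mulrA.
have -> : \sum_d \sum_t Wlow ht Wt (f x) d * Wlow ht Wt (f x) t * Aup ht f x i d * Aup ht f x j t =
    wu 0 i * wu 0 j.
  rewrite -!wupE mulr_suml; apply: eq_bigr => d _; rewrite mulr_sumr; apply: eq_bigr => t _.
  by rewrite !WlE; move: (Wl d) (Wl t) (Aup ht f x i d) (Aup ht f x j t) => u1 u2 u3 u4; ring.
by [].
Qed.
End IndexNotation.

Theorem theorem2p2 (R : realType) (n p : nat) (v : volume)
  (Ut : set 'rV[R]_(n + p)) (U : set 'rV[R]_n)
  (ht : 'rV[R]_(n + p) -> 'M[R]_(n + p))
  (Wt : 'rV[R]_(n + p) -> 'rV[R]_(n + p))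
  (f : 'rV[R]_n -> 'rV[R]_(n + p)) :
  open Ut -> open U ->
  (* h~ is a smooth Riemannian metric on Ut *)
  (forall a b, smooth_on Ut (fun y => ht y a b)) ->
  (forall x, Ut x -> (ht x)^T = ht x) ->
  (forall x, Ut x -> forall u : 'rV[R]_(n + p), u != 0 -> 0 < (u *m ht x *m u^T) 0 0) ->
  (* W~ is a smooth vector field with ||W~|| < 1, Killing for h~ *)
  (forall a, smooth_on Ut (fun y => Wt y 0 a)) ->
  (forall x, Ut x -> Wnorm2 ht Wt x < 1) ->
  Killing ht Wt Ut ->
  (* f : U -> Ut is a smooth immersion *)
  (forall x, U x -> Ut (f x)) ->
  (forall a, smooth_on U (fun y => f y 0 a)) ->
  (forall x, U x -> \rank (zf f x) = n) ->
  forall x, U x -> forall g : 'I_(n + p),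
  let s := sfrak ht Wt f x in
  let r := rho v n s in
  let r' := rho' v n s in
  let r'' := rho'' v n s in
  let lc' := logchi' v n (Wnorm2 ht Wt (f x)) in
  let Wl := Wlow ht Wt (f x) in
  let Wu := fun a => Wt (f x) 0 a in
  let Wc := Wcovlow ht Wt (f x) in
  let B := Bup ht f x in
  let Bm := Bmix ht f x in
  let A := Aup ht f x in
  let hh := hinv ht f x in
  let hb := ht (f x) in
  (* bracket  [2 r1 B^{e d} W_d W_t (delta^t_g - B^t_g) - r0 (delta^e_g - B^e_g)] *)
  let bra := fun (r1 r0 : R) (e : 'I_(n + p)) =>
     2 * r1 * (\sum_(d < n + p) \sum_(t < n + p)
                  B e d * Wl d * Wl t * (kron t g - Bm t g))
     - r0 * (kron e g - Bm e g) in
  (* W~_{a|e} W~^a *)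
  let WW := fun e : 'I_(n + p) => \sum_(a < n + p) Wc a e * Wu a in
  meancurv ht Wt f v x g =
    2 * lc' / r * (\sum_(e < n + p) bra r' r e * WW e)
  - r^-1 * (4 * r' * (\sum_(e < n + p) \sum_(b < n + p) \sum_(a < n + p)
                         B e b * Wc a e * Wl b * (kron a g - Bm a g))
            - 2 * (\sum_(e < n + p) bra r'' r' e * WW e))
  - r^-1 * (\sum_(a < n + p) \sum_(i < n) \sum_(j < n)
      (hh i j * (2 * r' * (\sum_(b < n + p) Wl a * Wl b * (kron b g - Bm b g))
                 + r * hb g a)
       + 2 * (\sum_(d < n + p) \sum_(t < n + p) Wl d * Wl t * A i d * A j t)
           * (2 * r'' * (\sum_(b < n + p) Wl a * Wl b * (kron b g - Bm b g))
              - r' * hb g a))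
      * tau ht f x a i j).
Proof.
move=> Uto Uo hts htsym htpos Wts Wlt Kil fU fs frank x Ux g.
cbv zeta.
have hT : (ht (f x))^T = ht (f x) by apply: htsym; exact: fU.
rewrite (sfrakE Wt hT) Wnorm2E.
have H1 := meancurv_covariant v Uto Uo hts htsym htpos Wts Wlt fU fs frank Ux g.
set S := ht (f x) *m Wcovmx ht Wt (f x).
(* The Killing equation, in the form used by [contract_w]. *)
have Santi : S^T = - S.
  apply/matrixP => a e; rewrite trmx_entry oppmxE -!WcovlowE.
  by apply/eqP; rewrite -addr_eq0; apply/eqP/Kil; exact: fU.
set r := rho v n _; set r1 := rho' v n _; set r2 := rho'' v n _; set lc := logchi' v n _.
have H2 := contract_w (Wt (f x))^T (zf f x) r r1 r2 lc hT g (erefl S) Santi.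
have tauE i a j : taumx ht f x i a j = tau ht f x a i j by exact: mxE.
have tsym := tau_sym Uto Uo hts htsym htpos Wlt fU fs frank Ux.
have tnorm := taumx_normal Uto Uo hts htsym htpos Wlt fU fs frank Ux.
have H3 := contract_normal (Wt (f x))^T r r1 r2 lc hT g tauE tsym tnorm.
apply: (meancurv_assembly H1 H2 H3).
- exact: sum_bra.
- exact: sum_curl.
- exact: sum_bra.
- exact: sum_tau.
Qed.
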